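(* Let $x_0\in\mathbb{C}$, let $\xi$ be a holomorphic function of one complex variable defined near $x_0$, and let $\mathcal{S}=\{(t,x)\in\mathbb{C}^2 : t=\xi(x)\}$ be the corresponding holomorphic surface. Let $f$ be an arbitrarily given holomorphic function of one complex variable defined near $x_0$. Then there exist an open neighbourhood $W$ of the point $(\xi(x_0),x_0)\in\mathcal{S}$ in $\mathbb{C}^2$ and a holomorphic function $h:W\to\mathbb{C}$ such that the function $$u(t,x)=-\frac{2}{t-\xi(x)}+h(t,x),\qquad (t,x)\in W\setminus\mathcal{S},$$ satisfies Burgers' equation $$u_x+u\,u_t=u_{tt}\qquad\text{on } W\setminus\mathcal{S},$$ and, for every $x$ with $(\xi(x),x)\in W$, the limit below exists and $$\lim_{t\to\xi(x)}\Bigl\{u_t(t,x)-\tfrac12\bigl(u(t,x)-\xi'(x)\bigr)^2\Bigr\}=f(x).$$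
   Context: Points of $\mathbb{C}^2$ are written $(t,x)$, with $t,x$ complex variables; subscripts denote complex partial derivatives. Burgers' equation is taken with the roles of $t$ and $x$ interchanged relative to the usual convention, i.e. $u_x+uu_t=u_{tt}$. The neighbourhood $W$ may be chosen small enough that $\xi(x)$ and $f(x)$ are defined for all $(t,x)\in W$, and it may depend on $\xi$, $f$ and $x_0$. *)

(* Defs.v *)
(* Stdlib reals with Coquelicot's complex numbers. *)
From Stdlib Require Import Reals.
From Coquelicot Require Export Coquelicot.

Open Scope C_scope.

(* A function on an open subset of C or C^2 is represented by a total function
   together with its domain; its values outside the domain are irrelevant. *)

Definition holomorphic_on (D : C -> Prop) (g : C -> C) : Prop :=
  forall z : C, D z -> ex_derive g z.

(* Frechet differentiability over the field C: the differential is required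
   to be a bounded C-linear map C^2 -> C. *)
Definition holomorphic2_on (W : C * C -> Prop) (h : C * C -> C) : Prop :=
  forall p : C * C, W p ->
    ex_filterdiff (K := C_AbsRing)
      (U := prod_NormedModule C_AbsRing C_NormedModule C_NormedModule)
      (V := C_NormedModule) h (locally p).

(* [C_derive] is the complex derivative only where the latter exists; [ex_dt]
   and [ex_dx] express that existence. *)
Definition ex_dt (u : C * C -> C) (p : C * C) : Prop :=
  ex_derive (fun t : C => u (t, snd p)) (fst p).

Definition ex_dx (u : C * C -> C) (p : C * C) : Prop :=
  ex_derive (fun x : C => u (fst p, x)) (snd p).

Definition dt (u : C * C -> C) (p : C * C) : C :=
  C_derive (fun t : C => u (t, snd p)) (fst p).

Definition dx (u : C * C -> C) (p : C * C) : C :=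
  C_derive (fun x : C => u (fst p, x)) (snd p).

(* The roles of t and x are interchanged relative to the usual convention. *)
Definition Burgers_on (D : C * C -> Prop) (u : C * C -> C) : Prop :=
  forall p : C * C, D p ->
    ex_dt u p /\ ex_dx u p /\ ex_dt (dt u) p /\
    dx u p + u p * dt u p = dt (dt u) p.

Definition surface (xi : C -> C) (p : C * C) : Prop := fst p = xi (snd p).

(* Main.v *)
Require Import Defs.
From Stdlib Require Import Reals Factorial Psatz.
From Coquelicot Require Import Coquelicot.

(** By the Cole-Hopf substitution [u = -2 chi_t / chi], Burgers' equation follows from
    [chi_x + k(x) chi = chi_tt] for any function [k] of [x] alone. With [s = t - xi(x)], look for
    [chi = sum_n d_n(x) s^n / n!] vanishing to first order at [s = 0]: [d_0 = 0], [d_1 = 1], and the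
    equation reads [d_(n+2) = d_n' + k d_n - xi' d_(n+1)]. Expanding at [s = 0] gives
    [-2 k - xi'^2 / 2] for the required limit, which fixes [k = -(f + xi'^2 / 2) / 2].
    The regular part is [h = -2 psi_s / psi] with [psi = chi / s].

    The series converges by Cauchy's estimate, applied [n] times with radius proportional to [1/n].
    For a merely differentiable [f], Goursat's theorem applied to [w |-> f(z + e^w) e^(-w)] on
    [[a, log r] x [0, 2 pi]], with [a] tending to minus infinity, gives
    [2 pi f'(z) = int_0^(2 pi) f(z + r e^(i y)) e^(-i y) / r dy]. This yields Cauchy's estimate, and
    Cauchy's estimate applied to difference quotients of [f] shows that [f'] is again
    differentiable. *)

(** The equation for [chi] is of second order in t and of first order in x, so the surface is
    noncharacteristic and the data [chi = 0], [chi_t = 1] on it form an analytic Cauchy problem.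
    Multiplying [chi] by a function g of x alone leaves u unchanged and replaces k by [k - g'/g];
    hence [d_1 = 1] costs no generality, and the single free function k matches the single
    prescribed f. The simple zero of [chi] produces the pole [-2/s]. The obstacle is that each step
    of the recursion may differentiate once more. The coefficient [d_n] is therefore bounded on a
    disc that has shrunk n times by r; with [r = R0/(2n)] a fixed half disc remains, the bound is
    [(c n)^n], and division by n! leaves geometric growth because [n^n <= 3^n n!]. Holomorphy here
    means one complex derivative, while the recursion uses derivatives of all orders; this is why
    Cauchy theory comes first. In the coordinate [e^w] a circle becomes a segment, so the rectangle
    form of Goursat's theorem suffices. *)

Open Scope C_scope.

(** * Differentiation of functions of one complex variable *)

(* Coquelicot puts two uniform structures on C, the product one and the one
   coming from the modulus. *)
Lemma locally_C_iff (z : C) (P : C -> Prop) :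
  locally (T := C_UniformSpace) z P <->
  exists d : R, (0 < d)%R /\ forall w, (Cmod (w - z) < d)%R -> P w.
Proof.
split.
- intros H.
  destruct (locally_norm_le_locally (V := C_NormedModule) z P H) as [d Hd].
  exists d; split; [apply cond_pos|].
  intros w Hw; apply Hd; exact Hw.
- intros [d [Hd H]].
  apply (locally_le_locally_norm (V := C_NormedModule) z P).
  exists (mkposreal d Hd); intros w Hw; apply H; exact Hw.
Qed.

Lemma locally_C_abs_iff (z : C) (P : C -> Prop) :
  locally (T := AbsRing_UniformSpace C_AbsRing) z P <->
  exists d : R, (0 < d)%R /\ forall w, (Cmod (w - z) < d)%R -> P w.
Proof.
split.
- intros [d Hd]; exists d; split; [apply cond_pos|exact Hd].
- intros [d [Hd H]]; exists (mkposreal d Hd); exact H.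
Qed.

Lemma is_derive_C_iff (f : C -> C) (z l : C) :
  is_derive f z l <->
  forall eps : R, (0 < eps)%R -> exists d : R, (0 < d)%R /\
    forall w, (Cmod (w - z) < d)%R ->
      (Cmod (f w - f z - l * (w - z)) <= eps * Cmod (w - z))%R.
Proof.
split.
- intros [_ H] eps Heps.
  specialize (H z (fun P HP => HP) (mkposreal eps Heps)).
  apply locally_C_abs_iff in H; destruct H as [d [Hd H]].
  exists d; split; [exact Hd|]; intros w Hw; specialize (H w Hw).
  rewrite (Cmult_comm l); exact H.
- intros H; split; [apply is_linear_scal_l|].
  intros y Hy.
  rewrite <- (is_filter_lim_locally_unique (V := AbsRing_NormedModule C_AbsRing) z y Hy); clear y Hy.
  intros [eps Heps].
  destruct (H eps Heps) as [d [Hd Hw]].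
  apply locally_C_abs_iff; exists d; split; [exact Hd|]; intros w Hd'.
  specialize (Hw w Hd'); rewrite (Cmult_comm l) in Hw; exact Hw.
Qed.

Lemma continuous_C_iff (f : C -> C) (z : C) :
  continuous (T := AbsRing_UniformSpace C_AbsRing) (U := C_UniformSpace) f z <->
  forall eps : R, (0 < eps)%R -> exists d : R, (0 < d)%R /\
    forall w, (Cmod (w - z) < d)%R -> (Cmod (f w - f z) < eps)%R.
Proof.
split.
- intros H eps Heps.
  apply locally_C_abs_iff, (H (fun y => (Cmod (y - f z) < eps)%R)), locally_C_iff.
  exists eps; split; auto.
- intros H P HP.
  apply locally_C_iff in HP; destruct HP as [eps [Heps HP]].
  destruct (H eps Heps) as [d [Hd Hw]].
  apply locally_C_abs_iff; exists d; split; [exact Hd|]; auto.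
Qed.

(** Integrals along segments live in the real module, and [norm_RInt_le_const] bounds them in its
    norm. *)
Lemma norm_C_R (z : C) : norm (z : C_R_NormedModule) = Cmod z.
Proof.
unfold norm, Cmod; simpl; unfold prod_norm, norm; simpl; unfold abs; simpl.
rewrite !Rmult_1_r, <- !Rabs_mult, !Rabs_pos_eq by apply Rle_0_sqr; reflexivity.
Qed.

Lemma scal_C_R (x : R) (z : C) : scal x (z : C_R_NormedModule) = RtoC x * z.
Proof.
apply injective_projections; simpl; unfold scal; simpl; unfold mult; simpl; ring.
Qed.

(** The bridge to real calculus: the mean value inequality and all path integrals run along such
    lines. *)
Lemma is_derive_line (f : C -> C) (z v l : C) (t : R) :
  is_derive f (z + t * v) l ->
  is_derive (K := R_AbsRing) (V := C_R_NormedModule)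
    (fun s : R => f (z + s * v)) t (l * v).
Proof.
intros H; rewrite is_derive_C_iff in H.
split; [apply is_linear_scal_l|].
intros y Hy; rewrite <- (is_filter_lim_locally_unique (V := AbsRing_NormedModule R_AbsRing) t y Hy); clear y Hy.
intros [eps Heps].
(* The added 1 keeps the divisor positive when [v = 0]. *)
assert (Hv : (0 < Cmod v + 1)%R) by (pose proof (Cmod_ge_0 v); lra).
destruct (H (eps / (Cmod v + 1))%R) as [d [Hd Hw]].
{ apply Rdiv_lt_0_compat; assumption. }
assert (Hd' : (0 < d / (Cmod v + 1))%R) by (apply Rdiv_lt_0_compat; assumption).
exists (mkposreal _ Hd'); intros s Hs.
assert (E : z + s * v - (z + t * v) = RtoC (s - t) * v) by (rewrite RtoC_minus; ring).
assert (Hs' : (Rabs (s - t) < d / (Cmod v + 1))%R) by exact Hs.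
specialize (Hw (z + s * v)).
rewrite E, Cmod_mult, Cmod_R in Hw.
assert (L1 : (Rabs (s - t) * Cmod v <= Rabs (s - t) * (Cmod v + 1))%R).
{ apply Rmult_le_compat_l; [apply Rabs_pos|lra]. }
assert (L2 : (Rabs (s - t) * (Cmod v + 1) < d)%R).
{ apply (Rmult_lt_compat_r (Cmod v + 1)) in Hs'; [|exact Hv].
  replace (d / (Cmod v + 1) * (Cmod v + 1))%R with d in Hs' by (field; lra).
  exact Hs'. }
specialize (Hw ltac:(lra)).
rewrite scal_C_R, norm_C_R.
change (Cmod (f (z + s * v)%C - f (z + t * v)%C - RtoC (s - t) * (l * v))
  <= eps * Rabs (s - t))%R.
replace (RtoC (s - t) * (l * v)) with (l * (RtoC (s - t) * v)) by ring.
eapply Rle_trans; [exact Hw|].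
replace (eps * Rabs (s - t))%R
  with (eps / (Cmod v + 1) * (Rabs (s - t) * (Cmod v + 1)))%R by (field; lra).
apply Rmult_le_compat_l; [|exact L1].
apply Rlt_le, Rdiv_lt_0_compat; assumption.
Qed.

Lemma Cmod_abs_sub (a b : C) : (Cmod a - Cmod b <= Cmod (a - b))%R.
Proof.
pose proof (Cmod_triangle (a - b) b) as H.
replace (a - b + b) with a in H by ring; lra.
Qed.

(** Within distance [eps / (|B| + 1)] a quadratic remainder is at most [eps] times the distance. The
    inverse, the exponential and [C_derive f] are differentiated through this criterion. *)
Lemma is_derive_C_quadratic (f : C -> C) (z l : C) (d B : R) :
  (0 < d)%R ->
  (forall w, (Cmod (w - z) < d)%R ->
     (Cmod (f w - f z - l * (w - z)) <= B * Cmod (w - z) ^ 2)%R) ->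
  is_derive f z l.
Proof.
intros Hd H; apply is_derive_C_iff; intros eps Heps.
assert (HB : (0 < Rabs B + 1)%R) by (pose proof (Rabs_pos B); lra).
exists (Rmin d (eps / (Rabs B + 1))); split.
{ apply Rmin_pos; [exact Hd|apply Rdiv_lt_0_compat; assumption]. }
intros w Hw.
pose proof (Rmin_l d (eps / (Rabs B + 1))); pose proof (Rmin_r d (eps / (Rabs B + 1))).
eapply Rle_trans; [apply H; lra|].
pose proof (Cmod_ge_0 (w - z)) as P.
assert (Q : (Cmod (w - z) * (Rabs B + 1) <= eps)%R).
{ apply (Rmult_le_reg_r (/ (Rabs B + 1))); [apply Rinv_0_lt_compat, HB|].
  rewrite Rmult_assoc, Rinv_r, Rmult_1_r by lra. unfold Rdiv in *; lra. }
pose proof (Rle_abs B).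
simpl; rewrite Rmult_1_r, <- Rmult_assoc.
apply Rmult_le_compat_r; [exact P|nra].
Qed.

(** The product and chain rules speak of the ring as a module over itself. That structure and
    [C_NormedModule] share their norm, so the estimate carries over by conversion. *)
Lemma is_derive_C_abs_iff (f : C -> C) (z l : C) :
  is_derive (V := AbsRing_NormedModule C_AbsRing) f z l <->
  is_derive (V := C_NormedModule) f z l.
Proof. split; (intros [_ H]; split; [apply is_linear_scal_l|exact H]). Qed.

Lemma is_derive_Cconst (a z : C) : is_derive (fun _ : C => a) z (RtoC 0).
Proof. apply (is_derive_const (V := C_NormedModule)). Qed.

Lemma is_derive_Cid (z : C) : is_derive (fun w : C => w) z (RtoC 1).
Proof.
apply (is_derive_C_quadratic _ _ _ 1 0 Rlt_0_1); intros w _.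
replace (w - z - 1 * (w - z)) with (RtoC 0) by ring.
rewrite Cmod_0; lra.
Qed.

Lemma is_derive_Cplus (f g : C -> C) (z a b : C) :
  is_derive f z a -> is_derive g z b -> is_derive (fun w => f w + g w) z (a + b).
Proof. apply (is_derive_plus (V := C_NormedModule)). Qed.

Lemma is_derive_Cminus (f g : C -> C) (z a b : C) :
  is_derive f z a -> is_derive g z b -> is_derive (fun w => f w - g w) z (a - b).
Proof. apply (is_derive_minus (V := C_NormedModule)). Qed.

Lemma is_derive_Cmult (f g : C -> C) (z a b : C) :
  is_derive f z a -> is_derive g z b ->
  is_derive (fun w => f w * g w) z (a * g z + f z * b).
Proof.
intros Hf Hg; apply is_derive_C_abs_iff.
apply is_derive_C_abs_iff in Hf; apply is_derive_C_abs_iff in Hg.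
exact (is_derive_mult (K := C_AbsRing) f g z a b Hf Hg Cmult_comm).
Qed.

Lemma is_derive_Cscal (c : C) (f : C -> C) (z a : C) :
  is_derive f z a -> is_derive (fun w => c * f w) z (c * a).
Proof.
intros Hf.
replace (c * a) with (0 * f z + c * a) by ring.
apply is_derive_Cmult; [apply is_derive_Cconst|exact Hf].
Qed.

Lemma is_derive_Ccomp (f g : C -> C) (z a b : C) :
  is_derive f (g z) a -> is_derive g z b ->
  is_derive (fun w => f (g w)) z (b * a).
Proof.
intros Hf Hg; apply is_derive_C_abs_iff in Hg.
exact (is_derive_comp (V := C_NormedModule) f g z a b Hf Hg).
Qed.

Lemma is_derive_Cinv (z : C) : z <> 0 -> is_derive Cinv z (- (/ (z * z))).
Proof.
intros Hz; assert (P : (0 < Cmod z)%R) by (apply Cmod_gt_0, Hz).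
(* The remainder is exactly [(w - z)^2 / (w z^2)], and [|w| > |z| / 2] on this disc. *)
apply (is_derive_C_quadratic _ _ _ (Cmod z / 2)%R (2 / Cmod z ^ 3)%R); [lra|].
intros w Hw.
assert (Q : (Cmod z / 2 < Cmod w)%R).
{ pose proof (Cmod_abs_sub z w) as T.
  replace (z - w) with (- (w - z)) in T by ring; rewrite Cmod_opp in T; lra. }
assert (Hw0 : w <> 0) by (apply Cmod_gt_0; lra).
replace (/ w - / z - - / (z * z) * (w - z))
  with ((w - z) * (w - z) / (w * (z * z))) by (field; split; assumption).
rewrite Cmod_div, !Cmod_mult by (repeat apply Cmult_neq_0; assumption).
pose proof (Cmod_ge_0 (w - z)).
apply (Rmult_le_reg_r (Cmod w * (Cmod z * Cmod z))).
{ repeat apply Rmult_lt_0_compat; lra. }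
replace (Cmod (w - z) * Cmod (w - z) / (Cmod w * (Cmod z * Cmod z)) *
  (Cmod w * (Cmod z * Cmod z)))%R with (Cmod (w - z) ^ 2)%R by (field; lra).
replace (2 / Cmod z ^ 3 * Cmod (w - z) ^ 2 * (Cmod w * (Cmod z * Cmod z)))%R
  with ((Cmod w / (Cmod z / 2)) * Cmod (w - z) ^ 2)%R by (field; lra).
rewrite <- (Rmult_1_l (Cmod (w - z) ^ 2)) at 1.
apply Rmult_le_compat_r; [apply pow2_ge_0|].
apply (Rmult_le_reg_r (Cmod z / 2)); [lra|].
replace (Cmod w / (Cmod z / 2) * (Cmod z / 2))%R with (Cmod w) by (field; lra).
lra.
Qed.

Lemma is_derive_Cdiv (f g : C -> C) (z a b : C) :
  g z <> 0 -> is_derive f z a -> is_derive g z b ->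
  is_derive (fun w => f w / g w) z ((a * g z - f z * b) / (g z * g z)).
Proof.
intros H Hf Hg.
replace ((a * g z - f z * b) / (g z * g z))
  with (a * / g z + f z * (b * - / (g z * g z))) by (field; exact H).
apply (is_derive_Cmult f (fun w => / g w)); [exact Hf|].
apply is_derive_Ccomp; [apply is_derive_Cinv, H|exact Hg].
Qed.

Lemma is_derive_C_ext (f g : C -> C) (z l : C) :
  (forall w, f w = g w) -> is_derive f z l -> is_derive g z l.
Proof. apply (is_derive_ext (V := C_NormedModule)). Qed.

Lemma is_derive_Cpow (n : nat) (z : C) :
  is_derive (fun w => w ^ S n) z (INR (S n) * z ^ n).
Proof.
induction n as [|n IH].
- apply (is_derive_C_ext (fun w => w)); [intros w; simpl; ring|].
  replace (INR 1 * z ^ 0) with (RtoC 1) by (simpl; ring). apply is_derive_Cid.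
- apply (is_derive_C_ext (fun w => w * w ^ S n)); [reflexivity|].
  replace (INR (S (S n)) * z ^ S n) with (1 * z ^ S n + z * (INR (S n) * z ^ n)).
  2:{ rewrite (S_INR (S n)), RtoC_plus; simpl; ring. }
  apply is_derive_Cmult; [apply is_derive_Cid|exact IH].
Qed.

Lemma is_derive_C_continuous (f : C -> C) (z l : C) :
  is_derive f z l ->
  continuous (T := AbsRing_UniformSpace C_AbsRing) (U := C_UniformSpace) f z.
Proof. intros H; apply (ex_derive_continuous (V := C_NormedModule) f z); exists l; exact H. Qed.

Lemma is_derive_C_ext_loc (f g : C -> C) (z l : C) (d : R) :
  (0 < d)%R -> (forall w, (Cmod (w - z) < d)%R -> f w = g w) ->
  is_derive f z l -> is_derive g z l.
Proof.
intros Hd H.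
apply (is_derive_ext_loc (V := C_NormedModule)), locally_C_abs_iff.
exists d; split; assumption.
Qed.

Lemma is_derive_C_uniq (f : C -> C) (z a b : C) :
  is_derive f z a -> is_derive f z b -> a = b.
Proof.
intros Ha Hb; rewrite <- (is_C_derive_unique f z a Ha).
apply is_C_derive_unique, Hb.
Qed.

Lemma is_derive_C_derive (f : C -> C) (z : C) :
  ex_derive f z -> is_derive f z (C_derive f z).
Proof. intros H; apply C_derive_correct; [exact 0|exact H]. Qed.

(** Projecting onto the direction of the increment [D] reduces to the real mean value theorem:
    [phi 1 - phi 0 = |D|^2], while [|phi'| <= |D| M |y|]; then [|D|] cancels. *)
Lemma Cmod_mean_value (f df : C -> C) (z y : C) (M : R) :
  (forall t : R, (0 <= t <= 1)%R ->
     is_derive f (z + t * y) (df (z + t * y)) /\ (Cmod (df (z + t * y)%C) <= M)%R) ->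
  (Cmod (f (z + y)%C - f z) <= M * Cmod y)%R.
Proof.
intros H.
set (D := f (z + y) - f z).
set (phi := fun t : R => Re (Cconj D * f (z + t * y))).
assert (Hd : forall t : R, (0 <= t <= 1)%R ->
  is_derive phi t (Re (Cconj D * df (z + t * y) * y))).
{ intros t Ht; destruct (H t Ht) as [Ht1 _].
  assert (L := is_derive_line (fun w => Cconj D * f w) z y _ t
    (is_derive_Cscal (Cconj D) f _ _ Ht1)).
  apply (filterdiff_ext_lin _ (fun s : R_AbsRing =>
    fst (scal s (Cconj D * df (z + t * y) * y : C_R_NormedModule)))).
  - apply (filterdiff_comp' (V := C_R_NormedModule) (W := R_NormedModule) _
      (fun p => fst p) t _ (fun p => fst p)); [exact L|].
    apply filterdiff_linear, is_linear_fst.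
  - intros s; reflexivity. }
destruct (MVT_gen phi 0 1 (fun t => Re (Cconj D * df (z + t * y) * y)))
  as [c [Hc E]].
{ rewrite Rmin_left, Rmax_right by lra. intros t Ht; apply Hd; lra. }
{ rewrite Rmin_left, Rmax_right by lra. intros t Ht.
  apply continuity_pt_filterlim, (ex_derive_continuous phi t).
  eexists; apply Hd, Ht. }
rewrite Rmin_left, Rmax_right in Hc by lra.
assert (E2 : (phi 1 - phi 0 = Cmod D ^ 2)%R).
{ unfold phi; rewrite Cmod2_alt.
  replace (z + RtoC 1 * y) with (z + y) by ring.
  replace (z + RtoC 0 * y) with z by ring.
  unfold D, Re, Im; simpl; ring. }
destruct (H c Hc) as [_ HM].
pose proof (re_le_Cmod (Cconj D * df (z + c * y) * y)) as P.
rewrite !Cmod_mult, Cmod_conj in P.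
pose proof (Rle_abs (Re (Cconj D * df (z + c * y) * y))).
pose proof (Cmod_ge_0 D); pose proof (Cmod_ge_0 y).
destruct (Req_dec (Cmod D) 0) as [Z|Z].
{ rewrite Z; pose proof (Cmod_ge_0 (df (z + c * y)%C)); nra. }
apply (Rmult_le_reg_l (Cmod D)); [lra|].
replace (Cmod D * Cmod D)%R with (Cmod D ^ 2)%R by ring.
assert (Cmod D * Cmod (df (z + c * y)%C) * Cmod y <= Cmod D * (M * Cmod y))%R.
{ rewrite Rmult_assoc; apply Rmult_le_compat_l; [lra|].
  apply Rmult_le_compat_r; [lra|exact HM]. }
lra.
Qed.

(** * The complex exponential *)

Definition Cexp (w : C) : C := (exp (Re w) * cos (Im w), exp (Re w) * sin (Im w))%R.

Lemma Cexp_plus (a b : C) : Cexp (a + b) = Cexp a * Cexp b.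
Proof.
unfold Cexp, Re, Im; simpl.
rewrite exp_plus, cos_plus, sin_plus.
apply injective_projections; simpl; ring.
Qed.

Lemma Cmod_Cexp (w : C) : Cmod (Cexp w) = exp (Re w).
Proof.
unfold Cexp, Cmod; simpl.
pose proof (sin2_cos2 (Im w)) as H; unfold Rsqr in H.
replace (exp (Re w) * cos (Im w) * (exp (Re w) * cos (Im w) * 1) +
  exp (Re w) * sin (Im w) * (exp (Re w) * sin (Im w) * 1))%R
  with (exp (Re w) * exp (Re w))%R.
- apply sqrt_square, Rlt_le, exp_pos.
- transitivity (exp (Re w) * exp (Re w) * (sin (Im w) * sin (Im w) + cos (Im w) * cos (Im w)))%R;
  [rewrite H; ring|ring].
Qed.

(** The constant 7 is 4 for the real part plus 3 for the imaginary part. The bounds on sine and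
    cosine come from integrating [|cos| <= 1] repeatedly by the mean value inequality. *)
Lemma Cexp_remainder (v : C) :
  (Cmod v <= 1 / 2)%R -> (Cmod (Cexp v - 1 - v) <= 7 * Cmod v ^ 2)%R.
Proof.
destruct v as [x y]; intros Hv.
set (m := Cmod (x, y)) in *.
assert (Hx : (Rabs x <= m)%R) by apply (re_le_Cmod (x, y)).
assert (Hy : (Rabs y <= m)%R).
{ eapply Rle_trans; [apply Rmax_r|apply (Rmax_Cmod (x, y))]. }
assert (Hsin : forall t, (Rabs (sin t) <= Rabs t)%R).
{ intros t.
  pose proof (bounded_variation sin cos 1 0 t) as B.
  rewrite sin_0, !Rminus_0_r, Rmult_1_l in B; apply B; intros s _.
  split; [apply is_derive_sin|apply Rabs_le; pose proof (COS_bound s); lra]. }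
assert (Hcos : forall t, (Rabs (cos t - 1) <= Rabs t * Rabs t)%R).
{ intros t.
  pose proof (bounded_variation cos (fun s => - sin s)%R (Rabs t) 0 t) as B.
  rewrite cos_0, Rminus_0_r in B; apply B; intros s Hs.
  split; [apply is_derive_cos|rewrite Rabs_Ropp].
  rewrite Rminus_0_r in Hs; eapply Rle_trans; [apply Hsin|exact Hs]. }
assert (Hsin3 : (Rabs (sin y - y) <= Rabs y * Rabs y * Rabs y)%R).
{ pose proof (bounded_variation (fun t => sin t - t)%R (fun s => cos s - 1)%R
    (Rabs y * Rabs y) 0 y) as B.
  cbv beta in B.
  rewrite sin_0, !Rminus_0_r in B; apply B; intros s Hs.
  rewrite Rminus_0_r in Hs.
  split; [auto_derive; [exact I|ring]|].
  eapply Rle_trans; [apply Hcos|].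
  pose proof (Rabs_pos s); apply Rmult_le_compat; lra. }
assert (E1 := exp_ineq1_le x).
assert (E2 := exp_ineq1_le (- x)).
assert (E3 : (exp x * exp (- x) = 1)%R) by (rewrite <- exp_plus, Rplus_opp_r; apply exp_0).
assert (Bx := Rabs_def2 x (1/2 + 1/4) ltac:(lra)).
pose proof (Rle_abs x); pose proof (Rle_abs (- x)) as Bx'; rewrite Rabs_Ropp in Bx'.
(* This is [1 - x <= exp (- x)] multiplied by [exp x]. As [x <= 1/2], it bounds [exp x] by 2 and
   [exp x - 1 - x] by [2 x^2]. *)
assert (E4 : (exp x * (1 - x) <= 1)%R).
{ rewrite <- E3; apply Rmult_le_compat_l; [apply Rlt_le, exp_pos|lra]. }
assert (E5 : (exp x <= 2)%R) by nra.
assert (E6 : (Rabs (exp x - 1 - x) <= 2 * (Rabs x * Rabs x))%R).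
{ rewrite <- Rabs_mult, (Rabs_pos_eq (x * x)) by apply Rle_0_sqr.
  rewrite Rabs_pos_eq by lra. nra. }
assert (Ex := exp_pos x).
assert (R1 : (Rabs (exp x * cos y - 1 - x) <= 4 * m ^ 2)%R).
{ replace (exp x * cos y - 1 - x)%R with (exp x * (cos y - 1) + (exp x - 1 - x))%R by ring.
  eapply Rle_trans; [apply Rabs_triang|].
  rewrite Rabs_mult, (Rabs_pos_eq (exp x)) by lra.
  pose proof (Hcos y); pose proof (Rabs_pos y); pose proof (Rabs_pos x).
  pose proof (Rabs_pos (cos y - 1)).
  assert (Rabs x * Rabs x <= m ^ 2)%R by nra.
  assert (Rabs y * Rabs y <= m ^ 2)%R by nra. nra. }
assert (R2 : (Rabs (exp x * sin y - y) <= 3 * m ^ 2)%R).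
{ replace (exp x * sin y - y)%R
    with (exp x * (sin y - y) + ((exp x - 1 - x) * y + x * y))%R by ring.
  eapply Rle_trans; [apply Rabs_triang|].
  eapply Rle_trans; [apply Rplus_le_compat_l, Rabs_triang|].
  rewrite !Rabs_mult, (Rabs_pos_eq (exp x)) by lra.
  pose proof (Rabs_pos y); pose proof (Rabs_pos x).
  pose proof (Rabs_pos (sin y - y)); pose proof (Rabs_pos (exp x - 1 - x)).
  assert (Rabs x * Rabs x <= m / 2)%R by nra.
  assert (Rabs y * Rabs y <= m ^ 2)%R by nra.
  assert (Rabs x * Rabs y <= m ^ 2)%R by nra.
  assert (Rabs y * Rabs y * Rabs y <= m ^ 2 / 2)%R by nra.
  assert (Rabs (exp x - 1 - x) * Rabs y <= m ^ 2)%R by nra.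
  nra. }
replace (Cexp (x, y) - 1 - (x, y))
  with (RtoC (exp x * cos y - 1 - x) + Ci * RtoC (exp x * sin y - y)).
2:{ apply injective_projections; unfold Cexp, Re, Im; simpl; ring. }
eapply Rle_trans; [apply Cmod_triangle|].
rewrite Cmod_mult, !Cmod_R, Cmod_Ci. lra.
Qed.

Lemma is_derive_Cexp (w : C) : is_derive Cexp w (Cexp w).
Proof.
apply (is_derive_C_quadratic _ _ _ (1/2)%R (exp (Re w) * 7)%R); [lra|].
intros v Hv.
replace (Cexp v - Cexp w - Cexp w * (v - w))
  with (Cexp w * (Cexp (v - w) - 1 - (v - w))).
- rewrite Cmod_mult, Cmod_Cexp, Rmult_assoc.
  apply Rmult_le_compat_l; [apply Rlt_le, exp_pos|apply Cexp_remainder; lra].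
- replace (Cexp v) with (Cexp w * Cexp (v - w)); [ring|].
  rewrite <- Cexp_plus; f_equal; ring.
Qed.

(** * Goursat's theorem *)

Lemma is_RInt_Cmult (c : C) (f : R -> C) (a b : R) (l : C) :
  is_RInt (V := C_R_NormedModule) f a b l ->
  is_RInt (V := C_R_NormedModule) (fun t => c * f t) a b (c * l).
Proof.
intros H.
assert (H1 := is_RInt_fct_extend_fst (U := R_NormedModule) (V := R_NormedModule) _ _ _ _ H).
assert (H2 := is_RInt_fct_extend_snd (U := R_NormedModule) (V := R_NormedModule) _ _ _ _ H).
apply (is_RInt_fct_extend_pair (U := R_NormedModule) (V := R_NormedModule)); simpl.
- apply (is_RInt_minus (V := R_NormedModule)); apply (is_RInt_scal (V := R_NormedModule)); assumption.
- apply (is_RInt_plus (V := R_NormedModule)); apply (is_RInt_scal (V := R_NormedModule)); assumption.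
Qed.

(** The factor [v] of the path integral is left out; [rect_int] supplies it, and the circle
    integrals below are stated without it. *)
Definition line_int (g : C -> C) (z v : C) (p q : R) : C :=
  RInt (V := C_R_CompleteNormedModule) (fun t => g (z + RtoC t * v)) p q.

Lemma continuous_line (g : C -> C) (z v : C) (t : R) :
  ex_derive g (z + RtoC t * v) ->
  continuous (U := C_R_NormedModule) (fun s : R => g (z + RtoC s * v)) t.
Proof.
intros [l Hl].
apply (ex_derive_continuous (V := C_R_NormedModule) (fun s : R => g (z + RtoC s * v)) t).
exists (l * v); apply is_derive_line, Hl.
Qed.

Lemma ex_line_int (g : C -> C) (z v : C) (p q : R) : (p <= q)%R ->
  (forall t : R, (p <= t <= q)%R -> ex_derive g (z + RtoC t * v)) ->
  ex_RInt (V := C_R_NormedModule) (fun t => g (z + RtoC t * v)) p q.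
Proof.
intros Hpq H; apply (ex_RInt_continuous (V := C_R_CompleteNormedModule)).
rewrite Rmin_left, Rmax_right by exact Hpq.
intros t Ht; apply continuous_line, H, Ht.
Qed.

Lemma line_int_correct (g : C -> C) (z v : C) (p q : R) : (p <= q)%R ->
  (forall t : R, (p <= t <= q)%R -> ex_derive g (z + RtoC t * v)) ->
  is_RInt (V := C_R_NormedModule) (fun t => g (z + RtoC t * v)) p q (line_int g z v p q).
Proof.
intros Hpq H; apply (RInt_correct (V := C_R_CompleteNormedModule)), ex_line_int; assumption.
Qed.

Lemma line_int_Chasles (g : C -> C) (z v : C) (p m q : R) : (p <= m <= q)%R ->
  (forall t : R, (p <= t <= q)%R -> ex_derive g (z + RtoC t * v)) ->
  line_int g z v p q = line_int g z v p m + line_int g z v m q.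
Proof.
intros Hm H; symmetry.
apply (RInt_Chasles (V := C_R_CompleteNormedModule)); apply ex_line_int; try lra;
  intros t Ht; apply H; lra.
Qed.

Lemma is_RInt_line_derive (G g : C -> C) (z v : C) (p q : R) : (p <= q)%R ->
  (forall t : R, (p <= t <= q)%R ->
     is_derive G (z + RtoC t * v) (g (z + RtoC t * v)) /\ ex_derive g (z + RtoC t * v)) ->
  is_RInt (V := C_R_NormedModule) (fun t => v * g (z + RtoC t * v)) p q
    (G (z + RtoC q * v) - G (z + RtoC p * v)).
Proof.
intros Hpq H.
apply (is_RInt_derive (V := C_R_CompleteNormedModule) (fun t : R => G (z + RtoC t * v)));
  rewrite Rmin_left, Rmax_right by exact Hpq; intros t Ht; destruct (H t Ht) as [H1 H2].
- rewrite (Cmult_comm v).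
  apply is_derive_line, H1.
- apply (continuous_line (fun w => v * g w)).
  destruct H2 as [l Hl]; exists (v * l); apply is_derive_Cscal, Hl.
Qed.

(** The integral of [a] is known exactly from its primitive [G], so only [g - a] needs a bound. It
    serves Goursat's theorem with [a] the affine approximation, and Cauchy's formula with [a] the
    leading part of the integrand. *)
Lemma line_int_close (G g a : C -> C) (z v : C) (p q eta : R) : (p <= q)%R ->
  Cmod v = 1%R ->
  (forall t : R, (p <= t <= q)%R ->
     is_derive G (z + RtoC t * v) (a (z + RtoC t * v)) /\ ex_derive a (z + RtoC t * v) /\
     ex_derive g (z + RtoC t * v) /\
     (Cmod (g (z + RtoC t * v)%C - a (z + RtoC t * v)%C) <= eta)%R) ->
  (Cmod (v * line_int g z v p q - (G (z + RtoC q * v)%C - G (z + RtoC p * v)%C))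
     <= (q - p) * eta)%R.
Proof.
intros Hpq Hv H.
rewrite <- norm_C_R.
apply (norm_RInt_le_const (V := C_R_NormedModule)
  (fun t => v * g (z + RtoC t * v) - v * a (z + RtoC t * v)) p q); [exact Hpq| |].
- intros t Ht; rewrite norm_C_R.
  replace (v * g (z + RtoC t * v) - v * a (z + RtoC t * v))
    with (v * (g (z + RtoC t * v) - a (z + RtoC t * v))) by ring.
  rewrite Cmod_mult, Hv, Rmult_1_l; apply H, Ht.
- apply (is_RInt_minus (V := C_R_NormedModule)).
  + apply is_RInt_Cmult, line_int_correct; [exact Hpq|intros t Ht; apply H, Ht].
  + apply is_RInt_line_derive; [exact Hpq|intros t Ht; split; apply H, Ht].
Qed.

(** Counterclockwise: bottom, top, right, left. The factors [1 *] give the horizontal sides the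
    shape required by [line_int_close]. *)
Definition rect_int (g : C -> C) (a b c d : R) : C :=
  1 * line_int g (RtoC c * Ci) 1 a b - 1 * line_int g (RtoC d * Ci) 1 a b
  + (Ci * line_int g (RtoC b) Ci c d - Ci * line_int g (RtoC a) Ci c d).

Definition holomorphic_rect (g : C -> C) (a b c d : R) : Prop :=
  forall x y : R, (a <= x <= b)%R -> (c <= y <= d)%R -> ex_derive g (RtoC x + RtoC y * Ci).

Lemma holomorphic_rect_h (g : C -> C) (a b c d y : R) :
  holomorphic_rect g a b c d -> (c <= y <= d)%R ->
  forall t : R, (a <= t <= b)%R -> ex_derive g (RtoC y * Ci + RtoC t * 1).
Proof.
intros H Hy t Ht.
replace (RtoC y * Ci + RtoC t * 1) with (RtoC t + RtoC y * Ci) by ring.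
apply H; assumption.
Qed.

(** Every inner side occurs twice, with opposite signs. *)
Lemma rect_int_quarters (g : C -> C) (a m b c n d : R) :
  (a <= m <= b)%R -> (c <= n <= d)%R -> holomorphic_rect g a b c d ->
  rect_int g a b c d =
  rect_int g a m c n + rect_int g m b c n + (rect_int g a m n d + rect_int g m b n d).
Proof.
intros Hm Hn H; unfold rect_int.
rewrite (line_int_Chasles g (RtoC c * Ci) 1 a m b), (line_int_Chasles g (RtoC d * Ci) 1 a m b),
  (line_int_Chasles g (RtoC b) Ci c n d), (line_int_Chasles g (RtoC a) Ci c n d);
  [ring|lra|intros t Ht; apply H; lra|lra|intros t Ht; apply H; lra
  |lra|apply (holomorphic_rect_h g a b c d); [exact H|lra]
  |lra|apply (holomorphic_rect_h g a b c d); [exact H|lra]].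
Qed.

(** The affine part [A] of [g] at [P] has the primitive [G], hence integral zero around the
    boundary. The rest is at most [e s] pointwise, with [s] half the perimeter, and is integrated
    over length [2 s]. *)
Lemma rect_int_local (g : C -> C) (a b c d x y e : R) (l : C) :
  (a <= x <= b)%R -> (c <= y <= d)%R -> holomorphic_rect g a b c d ->
  (0 <= e)%R ->
  (forall x' y' : R, (a <= x' <= b)%R -> (c <= y' <= d)%R ->
     (Cmod (g (RtoC x' + RtoC y' * Ci)%C - g (RtoC x + RtoC y * Ci)%C
        - l * ((RtoC x' + RtoC y' * Ci) - (RtoC x + RtoC y * Ci)))
      <= e * Cmod ((RtoC x' + RtoC y' * Ci) - (RtoC x + RtoC y * Ci)))%R) ->
  (Cmod (rect_int g a b c d) <= 2 * e * ((b - a) + (d - c)) ^ 2)%R.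
Proof.
intros Hx Hy H He Hl.
set (P := RtoC x + RtoC y * Ci) in *.
set (A := fun w => g P + l * (w - P)).
set (G := fun w => g P * w + l / 2 * ((w - P) * (w - P))).
assert (HG : forall w, is_derive G w (A w)).
{ intros w; unfold A, G.
  replace (g P + l * (w - P))
    with (g P * 1 + l / 2 * ((1 - 0) * (w - P) + (w - P) * (1 - 0))) by field.
  apply is_derive_Cplus; apply is_derive_Cscal; [apply is_derive_Cid|].
  assert (D : is_derive (fun w => w - P) w (1 - 0))
    by (apply is_derive_Cminus; [apply is_derive_Cid|apply is_derive_Cconst]).
  exact (is_derive_Cmult (fun w => w - P) (fun w => w - P) _ _ _ D D). }
assert (HA : forall w, ex_derive A w).
{ intros w; exists (0 + l * (1 - 0)); unfold A.
  apply is_derive_Cplus; [apply is_derive_Cconst|apply is_derive_Cscal].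
  apply is_derive_Cminus; [apply is_derive_Cid|apply is_derive_Cconst]. }
set (s := ((b - a) + (d - c))%R) in *.
assert (Hc : forall x' y' : R, (a <= x' <= b)%R -> (c <= y' <= d)%R ->
  (Cmod (g (RtoC x' + RtoC y' * Ci)%C - A (RtoC x' + RtoC y' * Ci)%C) <= e * s)%R).
{ intros x' y' Hx' Hy'; unfold A.
  replace (g (RtoC x' + RtoC y' * Ci) - (g P + l * (RtoC x' + RtoC y' * Ci - P)))
    with (g (RtoC x' + RtoC y' * Ci) - g P - l * (RtoC x' + RtoC y' * Ci - P)) by ring.
  eapply Rle_trans; [apply Hl; assumption|].
  apply Rmult_le_compat_l; [exact He|].
  replace (RtoC x' + RtoC y' * Ci - P) with (RtoC (x' - x) + RtoC (y' - y) * Ci).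
  2:{ unfold P; rewrite !RtoC_minus; ring. }
  eapply Rle_trans; [apply Cmod_triangle|].
  rewrite Cmod_mult, !Cmod_R, Cmod_Ci, Rmult_1_r; unfold s.
  apply Rplus_le_compat; apply Rabs_le; lra. }
assert (Eh : forall y', (c <= y' <= d)%R ->
  (Cmod (1 * line_int g (RtoC y' * Ci) 1 a b
     - (G (RtoC y' * Ci + RtoC b * 1)%C - G (RtoC y' * Ci + RtoC a * 1)%C))
   <= (b - a) * (e * s))%R).
{ intros y' Hy'; apply (line_int_close G g A); [lra|apply Cmod_1|].
  intros t Ht.
  replace (RtoC y' * Ci + RtoC t * 1) with (RtoC t + RtoC y' * Ci) by ring.
  refine (conj (HG _) (conj (HA _) (conj _ _))); [apply H|apply Hc]; assumption. }
assert (Ev : forall x', (a <= x' <= b)%R ->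
  (Cmod (Ci * line_int g (RtoC x') Ci c d
     - (G (RtoC x' + RtoC d * Ci)%C - G (RtoC x' + RtoC c * Ci)%C))
   <= (d - c) * (e * s))%R).
{ intros x' Hx'; apply (line_int_close G g A); [lra|apply Cmod_Ci|].
  intros t Ht.
  refine (conj (HG _) (conj (HA _) (conj _ _))); [apply H|apply Hc]; assumption. }
assert (E1 := Eh c ltac:(lra)); assert (E2 := Eh d ltac:(lra)).
assert (E3 := Ev b ltac:(lra)); assert (E4 := Ev a ltac:(lra)).
unfold rect_int.
match type of E1 with (Cmod (?u - _) <= _)%R => set (u1 := u) in * end.
match type of E2 with (Cmod (?u - _) <= _)%R => set (u2 := u) in * end.
match type of E3 with (Cmod (?u - _) <= _)%R => set (u3 := u) in * end.
match type of E4 with (Cmod (?u - _) <= _)%R => set (u4 := u) in * end.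
replace (RtoC c * Ci + RtoC b * 1) with (RtoC b + RtoC c * Ci) in E1 by ring.
replace (RtoC c * Ci + RtoC a * 1) with (RtoC a + RtoC c * Ci) in E1 by ring.
replace (RtoC d * Ci + RtoC b * 1) with (RtoC b + RtoC d * Ci) in E2 by ring.
replace (RtoC d * Ci + RtoC a * 1) with (RtoC a + RtoC d * Ci) in E2 by ring.
match type of E1 with (Cmod ?u <= _)%R => set (w1 := u) in * end.
match type of E2 with (Cmod ?u <= _)%R => set (w2 := u) in * end.
match type of E3 with (Cmod ?u <= _)%R => set (w3 := u) in * end.
match type of E4 with (Cmod ?u <= _)%R => set (w4 := u) in * end.
(* The corner values of [G] cancel around the rectangle. *)
replace (u1 - u2 + (u3 - u4)) with (w1 + - w2 + (w3 + - w4))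
  by (unfold w1, w2, w3, w4; ring).
assert (T1 := Cmod_triangle (w1 + - w2) (w3 + - w4)).
assert (T2 := Cmod_triangle w1 (- w2)); assert (T3 := Cmod_triangle w3 (- w4)).
rewrite Cmod_opp in T2, T3.
replace (2 * e * s ^ 2)%R
  with (2 * ((b - a) * (e * s)) + 2 * ((d - c) * (e * s)))%R by (unfold s; ring).
lra.
Qed.

(** * Bisection of rectangles *)

Lemma nested_intervals_point (a b : nat -> R) :
  (forall n, a n <= a (S n))%R -> (forall n, b (S n) <= b n)%R -> (forall n, a n <= b n)%R ->
  exists x : R, forall n, (a n <= x <= b n)%R.
Proof.
intros Ha Hb Hab.
assert (La : forall n k, (a n <= a (k + n)%nat)%R).
{ intros n k; induction k; simpl; [lra|specialize (Ha (k + n)%nat); lra]. }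
assert (Lb : forall n k, (b (k + n)%nat <= b n)%R).
{ intros n k; induction k; simpl; [lra|specialize (Hb (k + n)%nat); lra]. }
assert (L : forall n m, (a n <= b m)%R).
{ intros n m; specialize (La n m); specialize (Lb m n); specialize (Hab (m + n)%nat).
  rewrite Nat.add_comm in Lb; lra. }
destruct (completeness (fun r => exists n, r = a n)) as [x [H1 H2]].
- exists (b 0%nat); intros r [n ->]; apply L.
- exists (a 0%nat), 0%nat; reflexivity.
- exists x; intros n; split; [apply H1; exists n; reflexivity|].
  apply H2; intros r [m ->]; apply L.
Qed.

Section Bisection.

Variables (g : C -> C) (e : R).

(** The threshold is quadratic in the half perimeter because quartering halves the latter and splits
    the integral into four. *)
Let bad (q : R * R * R * R) : Prop :=
  let '(a, b, c, d) := q in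
  (e * ((b - a) + (d - c)) ^ 2 < Cmod (rect_int g a b c d))%R.

Let bad_dec (q : R * R * R * R) : {bad q} + {~ bad q}.
Proof. destruct q as [[[a b] c] d]; apply Rlt_dec. Defined.

(** Deciding [bad] makes the selection a function that can be iterated. The last quarter is the
    default: if the other three are not bad, it is the bad one. *)
Let quarter (q : R * R * R * R) : R * R * R * R :=
  let '(a, b, c, d) := q in
  let m := ((a + b) / 2)%R in
  let n := ((c + d) / 2)%R in
  if bad_dec (a, m, c, n) then (a, m, c, n) else
  if bad_dec (m, b, c, n) then (m, b, c, n) else
  if bad_dec (a, m, n, d) then (a, m, n, d) else (m, b, n, d).

Lemma quarter_cases (a b c d : R) (P : R * R * R * R -> Prop) :
  let m := ((a + b) / 2)%R in
  let n := ((c + d) / 2)%R in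
  P (a, m, c, n) -> P (m, b, c, n) -> P (a, m, n, d) -> P (m, b, n, d) ->
  P (quarter (a, b, c, d)).
Proof. intros m n H1 H2 H3 H4; unfold quarter; repeat destruct bad_dec; assumption. Qed.

Let halved (q q' : R * R * R * R) : Prop :=
  let '(a, b, c, d) := q in
  let '(a', b', c', d') := q' in
  (a <= a' <= b' /\ b' <= b /\ c <= c' <= d' /\ d' <= d /\
   (b' - a') + (d' - c') = ((b - a) + (d - c)) / 2)%R.

Lemma quarter_halved (a b c d : R) :
  (a <= b)%R -> (c <= d)%R -> halved (a, b, c, d) (quarter (a, b, c, d)).
Proof.
intros Hab Hcd.
apply (quarter_cases a b c d (halved (a, b, c, d))); unfold halved; repeat split; lra.
Qed.

(** Four quarters within the threshold would give at most [4 e (s/2)^2 = e s^2] in total. *)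
Lemma quarter_bad (a b c d : R) :
  (a <= b)%R -> (c <= d)%R -> holomorphic_rect g a b c d ->
  bad (a, b, c, d) -> bad (quarter (a, b, c, d)).
Proof.
intros Hab Hcd Hg H; unfold quarter.
destruct bad_dec as [B|B1]; [exact B|].
destruct bad_dec as [B|B2]; [exact B|].
destruct bad_dec as [B|B3]; [exact B|].
set (m := ((a + b) / 2)%R) in *; set (n := ((c + d) / 2)%R) in *.
unfold bad in *.
rewrite (rect_int_quarters g a m b c n d) in H; [|unfold m; lra|unfold n; lra|exact Hg].
pose proof (Cmod_triangle (rect_int g a m c n + rect_int g m b c n)
  (rect_int g a m n d + rect_int g m b n d)) as T1.
pose proof (Cmod_triangle (rect_int g a m c n) (rect_int g m b c n)) as T2.
pose proof (Cmod_triangle (rect_int g a m n d) (rect_int g m b n d)) as T3.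
assert (Em : (m - a = (b - a) / 2 /\ b - m = (b - a) / 2)%R) by (unfold m; lra).
assert (En : (n - c = (d - c) / 2 /\ d - n = (d - c) / 2)%R) by (unfold n; lra).
destruct Em as [Em1 Em2], En as [En1 En2].
rewrite Em1, En1 in B1; rewrite Em2, En1 in B2; rewrite Em1, En2 in B3; rewrite Em2, En2.
replace (e * ((b - a) / 2 + (d - c) / 2) ^ 2)%R
  with (e * (b - a + (d - c)) ^ 2 / 4)%R in * by field.
lra.
Qed.

(** The bad quarters shrink to a point [(x, y)], where differentiability of [g] contradicts badness
    of a small enough quarter. *)
Lemma no_bad_rect (a b c d : R) : (0 < e)%R ->
  (a <= b)%R -> (c <= d)%R -> holomorphic_rect g a b c d -> ~ bad (a, b, c, d).
Proof.
intros He Hab Hcd Hg Hbad.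
set (q := fix q n := match n with O => (a, b, c, d) | S k => quarter (q k) end).
set (qa := fun n => fst (fst (fst (q n)))); set (qb := fun n => snd (fst (fst (q n)))).
set (qc := fun n => snd (fst (q n))); set (qd := fun n => snd (q n)).
assert (Eq : forall n, q n = (qa n, qb n, qc n, qd n)).
{ intros n; unfold qa, qb, qc, qd; destruct (q n) as [[[? ?] ?] ?]; reflexivity. }
assert (Es : forall n, q (S n) = quarter (qa n, qb n, qc n, qd n)).
{ intros n; rewrite <- Eq; reflexivity. }
assert (I : forall n, (a <= qa n <= qb n)%R /\ (qb n <= b)%R /\
   (c <= qc n <= qd n)%R /\ (qd n <= d)%R /\
   ((qb n - qa n) + (qd n - qc n) = ((b - a) + (d - c)) / 2 ^ n)%R /\ bad (q n)).
{ induction n as [|n [I1 [I2 [I3 [I4 [I5 I6]]]]]].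
  - unfold qa, qb, qc, qd; simpl; repeat split; try lra; try field; exact Hbad.
  - assert (B : bad (q (S n))).
    { rewrite Es; apply quarter_bad; try lra.
      - intros x y Hx Hy; apply Hg; lra.
      - rewrite <- Eq; exact I6. }
    assert (Hh := quarter_halved (qa n) (qb n) (qc n) (qd n) ltac:(lra) ltac:(lra)).
    rewrite <- Es, Eq in Hh; unfold halved in Hh.
    replace ((b - a + (d - c)) / 2 ^ S n)%R
      with ((qb n - qa n + (qd n - qc n)) / 2)%R.
    2:{ rewrite I5; simpl; field; apply pow_nonzero; lra. }
    repeat split; try lra; exact B. }
assert (Mono : forall n, (qa n <= qa (S n))%R /\ (qb (S n) <= qb n)%R /\
   (qc n <= qc (S n))%R /\ (qd (S n) <= qd n)%R).
{ intros n; destruct (I n) as [I1 [I2 [I3 [I4 _]]]].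
  assert (Hh := quarter_halved (qa n) (qb n) (qc n) (qd n) ltac:(lra) ltac:(lra)).
  rewrite <- Es, Eq in Hh; unfold halved in Hh; lra. }
destruct (nested_intervals_point qa qb) as [x Hx]; try (intros n; apply Mono); try (intros n; apply I).
destruct (nested_intervals_point qc qd) as [y Hy]; try (intros n; apply Mono); try (intros n; apply I).
destruct (Hg x y) as [l Hl]; [apply (Hx 0%nat)|apply (Hy 0%nat)|].
rewrite is_derive_C_iff in Hl.
(* Half of [e], to absorb the factor 2 of [rect_int_local]. *)
destruct (Hl (e / 2)%R) as [r [Hr Hr']]; [lra|].
destruct (pow_lt_1_zero (1/2)%R ltac:(rewrite Rabs_pos_eq; lra)
  (r / ((b - a) + (d - c) + 1))%R) as [n Hn].
{ apply Rdiv_lt_0_compat; lra. }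
specialize (Hn n (Nat.le_refl n)).
destruct (I n) as [I1 [I2 [I3 [I4 [I5 I6]]]]].
rewrite Rabs_pos_eq in Hn by (apply pow_le; lra).
assert (Small : ((qb n - qa n) + (qd n - qc n) < r)%R).
{ rewrite I5; unfold Rdiv in *; rewrite Rmult_1_l, pow_inv in Hn.
  assert (0 < / 2 ^ n)%R by (apply Rinv_0_lt_compat, pow_lt; lra).
  apply (Rmult_lt_compat_l (b - a + (d - c) + 1)) in Hn; [|lra].
  replace ((b - a + (d - c) + 1) * (r * / (b - a + (d - c) + 1)))%R with r in Hn
    by (field; lra).
  lra. }
rewrite Eq in I6; unfold bad in I6.
apply (Rlt_not_le _ _ I6).
replace e with (2 * (e / 2))%R by field.
apply (rect_int_local g _ _ _ _ x y (e / 2) l); [apply Hx|apply Hy| |lra|].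
- intros x' y' Hx' Hy'; apply Hg; lra.
- intros x' y' Hx' Hy'; apply Hr'.
  replace (RtoC x' + RtoC y' * Ci - (RtoC x + RtoC y * Ci))
    with (RtoC (x' - x) + RtoC (y' - y) * Ci) by (rewrite !RtoC_minus; ring).
  eapply Rle_lt_trans; [apply Cmod_triangle|].
  rewrite Cmod_mult, !Cmod_R, Cmod_Ci, Rmult_1_r.
  eapply Rle_lt_trans; [|exact Small].
  specialize (Hx n); specialize (Hy n).
  apply Rplus_le_compat; apply Rabs_le; lra.
Qed.

End Bisection.

Lemma Goursat (g : C -> C) (a b c d : R) :
  (a <= b)%R -> (c <= d)%R -> holomorphic_rect g a b c d -> rect_int g a b c d = 0.
Proof.
intros Hab Hcd Hg; apply Cmod_eq_0.
apply Rle_antisym; [|apply Cmod_ge_0].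
apply Rnot_lt_le; intros H.
set (s := (b - a + (d - c))%R).
assert (Hs : (0 < s ^ 2 + 1)%R) by (pose proof (pow2_ge_0 s); lra).
(* For this [e] the product [e s^2] is below the modulus of the integral, so a nonzero integral
   makes the rectangle bad, even when [s = 0]. *)
apply (no_bad_rect g (Cmod (rect_int g a b c d) / (s ^ 2 + 1)) a b c d); try assumption.
- apply Rdiv_lt_0_compat; assumption.
- fold s.
  apply (Rmult_lt_reg_r (s ^ 2 + 1)); [exact Hs|].
  replace (Cmod (rect_int g a b c d) / (s ^ 2 + 1) * s ^ 2 * (s ^ 2 + 1))%R
    with (Cmod (rect_int g a b c d) * s ^ 2)%R by (field; lra).
  nra.
Qed.

(** * Cauchy's estimate and higher derivatives *)

Lemma exp_le_compat (x y : R) : (x <= y)%R -> (exp x <= exp y)%R.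
Proof. intros [H| ->]; [apply Rlt_le, exp_increasing, H|apply Rle_refl]. Qed.

Lemma Cexp_period (w : C) : Cexp (w + RtoC (2 * PI) * Ci) = Cexp w.
Proof.
unfold Cexp, Re, Im; simpl.
replace (fst w + (2 * PI * 0 - 0 * 1))%R with (fst w) by ring.
replace (snd w + (2 * PI * 1 + 0 * 0))%R with (snd w + 2 * PI)%R by ring.
rewrite cos_plus, sin_plus, cos_2PI, sin_2PI.
apply injective_projections; simpl; ring.
Qed.

Lemma Cexp_opp (w : C) : Cexp w * Cexp (- w) = 1.
Proof.
rewrite <- Cexp_plus; replace (w + - w) with (RtoC 0) by ring.
unfold Cexp; simpl; rewrite exp_0, cos_0, sin_0, Rmult_1_r, Rmult_0_r; reflexivity.
Qed.

Lemma Cmod_Cexp_line (x y : R) : Cmod (Cexp (RtoC x + RtoC y * Ci)) = exp x.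
Proof. rewrite Cmod_Cexp; f_equal; simpl; ring. Qed.

Lemma is_derive_Cexp_opp (w : C) : is_derive (fun v => Cexp (- v)) w (- Cexp (- w)).
Proof.
replace (- Cexp (- w)) with ((0 - 1) * Cexp (- w)) by ring.
apply (is_derive_Ccomp Cexp (fun v => - v)); [apply is_derive_Cexp|].
apply (is_derive_C_ext (fun v => 0 - v)); [intros v; ring|].
apply is_derive_Cminus; [apply is_derive_Cconst|apply is_derive_Cid].
Qed.

(** The Cauchy kernel for the derivative: [f(zeta) / (zeta - z)^2 dzeta] in the coordinate
    [zeta = z + e^w]. *)
Definition circle_integrand (f : C -> C) (z w : C) : C := f (z + Cexp w) * Cexp (- w).

Lemma ex_derive_circle_integrand (f : C -> C) (z w : C) :
  ex_derive f (z + Cexp w) -> ex_derive (circle_integrand f z) w.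
Proof.
intros [l Hl]; eexists; unfold circle_integrand.
apply (is_derive_Cmult (fun v => f (z + Cexp v)) (fun v => Cexp (- v)));
  [|apply is_derive_Cexp_opp].
apply (is_derive_Ccomp f (fun v => z + Cexp v)); [exact Hl|].
apply is_derive_Cplus; [apply is_derive_Cconst|apply is_derive_Cexp].
Qed.

(** The period [2 pi i] of the integrand cancels the horizontal sides, and Goursat's theorem then
    equates the two vertical ones. *)
Lemma circle_int_radius (f : C -> C) (z : C) (a b : R) : (a <= b)%R ->
  (forall v, (Cmod (v - z) <= exp b)%R -> ex_derive f v) ->
  line_int (circle_integrand f z) (RtoC b) Ci 0 (2 * PI) =
  line_int (circle_integrand f z) (RtoC a) Ci 0 (2 * PI).
Proof.
intros Hab Hf; pose proof PI_RGT_0 as Hpi.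
assert (G := Goursat (circle_integrand f z) a b 0 (2 * PI) Hab ltac:(lra)).
unfold rect_int in G.
assert (E : line_int (circle_integrand f z) (RtoC (2 * PI) * Ci) 1 a b =
  line_int (circle_integrand f z) (RtoC 0 * Ci) 1 a b).
{ apply (RInt_ext (V := C_R_CompleteNormedModule)); intros t _.
  unfold circle_integrand.
  replace (RtoC (2 * PI) * Ci + RtoC t * 1) with (RtoC t + RtoC (2 * PI) * Ci) by ring.
  rewrite Cexp_period.
  replace (- (RtoC t + RtoC (2 * PI) * Ci)) with (- RtoC t - RtoC (2 * PI) * Ci) by ring.
  rewrite <- (Cexp_period (- RtoC t - RtoC (2 * PI) * Ci)).
  replace (RtoC 0 * Ci + RtoC t * 1) with (RtoC t) by ring.
  do 3 f_equal; ring. }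
rewrite E in G; clear E.
match type of G with _ -> ?u - ?u + (Ci * ?x - Ci * ?y) = _ =>
  assert (E : x - y = - Ci * (u - u + (Ci * x - Ci * y))) end.
{ replace (- Ci * (1 * line_int (circle_integrand f z) (RtoC 0 * Ci) 1 a b -
    1 * line_int (circle_integrand f z) (RtoC 0 * Ci) 1 a b +
    (Ci * line_int (circle_integrand f z) (RtoC b) Ci 0 (2 * PI) -
    Ci * line_int (circle_integrand f z) (RtoC a) Ci 0 (2 * PI))))
  with (- (Ci * Ci) * (line_int (circle_integrand f z) (RtoC b) Ci 0 (2 * PI)
    - line_int (circle_integrand f z) (RtoC a) Ci 0 (2 * PI))) by ring.
  replace (- (Ci * Ci)) with (RtoC 1); [ring|].
  apply injective_projections; simpl; ring. }
rewrite G, Cmult_0_r in E.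
- match type of E with ?x - ?y = _ => replace x with (x - y + y) by ring end.
  rewrite E; ring.
- intros x y Hx Hy; apply ex_derive_circle_integrand, Hf.
  replace (z + Cexp (RtoC x + RtoC y * Ci) - z) with (Cexp (RtoC x + RtoC y * Ci)) by ring.
  rewrite Cmod_Cexp_line; apply exp_le_compat, Hx.
Qed.

(** On a small circle the integrand is uniformly close to [A w = l + f(z) e^(-w)]. Its primitive [G]
    increases by [2 pi i l] along the segment, since [e^(-w)] is periodic. *)
Lemma Cauchy_derivative_formula (f : C -> C) (z l : C) (b : R) :
  (forall v, (Cmod (v - z) <= exp b)%R -> ex_derive f v) ->
  is_derive f z l ->
  line_int (circle_integrand f z) (RtoC b) Ci 0 (2 * PI) = RtoC (2 * PI) * l.
Proof.
intros Hf Hl; pose proof PI_RGT_0 as Hpi.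
set (J := line_int (circle_integrand f z) (RtoC b) Ci 0 (2 * PI)).
assert (Bound : forall e, (0 < e)%R ->
  (Cmod (Ci * J - Ci * (RtoC (2 * PI) * l)) <= 2 * PI * e)%R).
{ intros e He.
  destruct (proj1 (is_derive_C_iff f z l) Hl e He) as [d [Hd Hw]].
  (* The radius [exp a] is at most [exp b] and strictly less than [d]. *)
  set (a := Rmin b (ln (d / 2))).
  assert (Ha1 : (a <= b)%R) by apply Rmin_l.
  assert (Ha2 : (exp a < d)%R).
  { apply Rle_lt_trans with (exp (ln (d / 2))); [apply exp_le_compat, Rmin_r|].
    rewrite exp_ln; lra. }
  unfold J; rewrite (circle_int_radius f z a b Ha1 Hf).
  set (G := fun w => l * w - f z * Cexp (- w)).
  set (A := fun w => l + f z * Cexp (- w)).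
  replace (Ci * (RtoC (2 * PI) * l))
    with (G (RtoC a + RtoC (2 * PI) * Ci) - G (RtoC a + RtoC 0 * Ci)).
  2:{ unfold G.
      replace (- (RtoC a + RtoC (2 * PI) * Ci)) with (- RtoC a - RtoC (2 * PI) * Ci) by ring.
      rewrite <- (Cexp_period (- RtoC a - RtoC (2 * PI) * Ci)).
      replace (- RtoC a - RtoC (2 * PI) * Ci + RtoC (2 * PI) * Ci)
        with (- (RtoC a + RtoC 0 * Ci)) by ring.
      ring. }
  replace (2 * PI * e)%R with ((2 * PI - 0) * e)%R by ring.
  apply (line_int_close G (circle_integrand f z) A); [lra|apply Cmod_Ci|].
  intros t Ht; set (w := RtoC a + RtoC t * Ci).
  assert (Hm : Cmod (Cexp w) = exp a) by apply Cmod_Cexp_line.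
  refine (conj _ (conj _ (conj _ _))).
  - unfold G, A.
    replace (l + f z * Cexp (- w)) with (l * 1 - f z * (- Cexp (- w))) by ring.
    apply is_derive_Cminus; apply is_derive_Cscal;
      [apply is_derive_Cid|apply is_derive_Cexp_opp].
  - exists (0 + f z * (- Cexp (- w))); unfold A.
    apply is_derive_Cplus; [apply is_derive_Cconst|apply is_derive_Cscal, is_derive_Cexp_opp].
  - apply ex_derive_circle_integrand, Hf.
    replace (z + Cexp w - z) with (Cexp w) by ring.
    rewrite Hm; apply exp_le_compat, Ha1.
  - assert (E := Cexp_opp w).
    replace (circle_integrand f z w - A w)
      with ((f (z + Cexp w) - f z - l * (z + Cexp w - z)) * Cexp (- w)).
    2:{ unfold circle_integrand, A.
        transitivity ((f (z + Cexp w) - f z) * Cexp (- w) - l * (Cexp w * Cexp (- w)));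
          [ring|rewrite E; ring]. }
    specialize (Hw (z + Cexp w)).
    replace (z + Cexp w - z) with (Cexp w) in * by ring.
    rewrite Hm in Hw; specialize (Hw Ha2).
    rewrite Cmod_mult.
    assert (E2 : (exp a * Cmod (Cexp (- w)) = 1)%R)
      by (rewrite <- Hm, <- Cmod_mult, E; apply Cmod_1).
    replace e with (e * exp a * Cmod (Cexp (- w)))%R by (rewrite Rmult_assoc, E2; ring).
    apply Rmult_le_compat_r; [apply Cmod_ge_0|exact Hw]. }
assert (Z : Cmod (Ci * J - Ci * (RtoC (2 * PI) * l)) = 0%R).
{ apply Rle_antisym; [|apply Cmod_ge_0].
  apply le_epsilon; intros e He.
  assert (He' : (0 < e / (2 * PI))%R) by (apply Rdiv_lt_0_compat; lra).
  specialize (Bound _ He').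
  replace (2 * PI * (e / (2 * PI)))%R with e in Bound by (field; lra). lra. }
replace (Ci * J - Ci * (RtoC (2 * PI) * l)) with (Ci * (J - RtoC (2 * PI) * l)) in Z by ring.
rewrite Cmod_mult, Cmod_Ci, Rmult_1_l in Z.
apply Cmod_eq_0 in Z.
replace J with (J - RtoC (2 * PI) * l + RtoC (2 * PI) * l) by ring.
rewrite Z; ring.
Qed.

Lemma Cauchy_estimate (f : C -> C) (z l : C) (r M : R) : (0 < r)%R ->
  (forall v, (Cmod (v - z) <= r)%R -> ex_derive f v /\ (Cmod (f v) <= M)%R) ->
  is_derive f z l -> (Cmod l <= M / r)%R.
Proof.
intros Hr Hf Hl; pose proof PI_RGT_0 as Hpi.
assert (Er : exp (ln r) = r) by (apply exp_ln, Hr).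
assert (Hd : forall v, (Cmod (v - z) <= exp (ln r))%R -> ex_derive f v).
{ intros v Hv; apply Hf; rewrite <- Er; exact Hv. }
assert (Hc : forall t, (Cmod (z + Cexp (RtoC (ln r) + RtoC t * Ci) - z) <= r)%R).
{ intros t.
  replace (z + Cexp (RtoC (ln r) + RtoC t * Ci) - z)
    with (Cexp (RtoC (ln r) + RtoC t * Ci)) by ring.
  rewrite Cmod_Cexp_line, Er; lra. }
assert (B : (Cmod (line_int (circle_integrand f z) (RtoC (ln r)) Ci 0 (2 * PI))
   <= (2 * PI - 0) * (M / r))%R).
{ rewrite <- norm_C_R.
  apply (norm_RInt_le_const (V := C_R_NormedModule)
    (fun t => circle_integrand f z (RtoC (ln r) + RtoC t * Ci)) 0 (2 * PI)); [lra| |].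
  - intros t _; rewrite norm_C_R; unfold circle_integrand.
    rewrite Cmod_mult, (Cmod_Cexp (- _)).
    replace (Re (- (RtoC (ln r) + RtoC t * Ci))) with (- ln r)%R by (simpl; ring).
    rewrite exp_Ropp, Er.
    apply Rmult_le_compat_r; [apply Rlt_le, Rinv_0_lt_compat, Hr|apply Hf, Hc].
  - apply line_int_correct; [lra|].
    intros t _; apply ex_derive_circle_integrand, Hf, Hc. }
rewrite (Cauchy_derivative_formula f z l _ Hd Hl), Cmod_mult, Cmod_R in B.
rewrite Rabs_pos_eq in B by lra.
apply (Rmult_le_reg_l (2 * PI)); lra.
Qed.

(** * Differentiability of the derivative *)

Lemma Cmod_sub_sym (a b : C) : Cmod (a - b) = Cmod (b - a).
Proof. replace (a - b) with (- (b - a)) by ring; apply Cmod_opp. Qed.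

Lemma Cmod_sub_triangle (a b c : C) : (Cmod (a - c) <= Cmod (a - b) + Cmod (b - c))%R.
Proof. replace (a - c) with (a - b + (b - c)) by ring; apply Cmod_triangle. Qed.

Lemma Cmod_segment (x0 z y : C) (t B : R) : (0 <= t <= 1)%R ->
  (Cmod (z - x0) < B)%R -> (Cmod (z + y - x0) < B)%R ->
  (Cmod (z + RtoC t * y - x0) < B)%R.
Proof.
intros Ht H1 H2.
replace (z + RtoC t * y - x0) with (RtoC (1 - t) * (z - x0) + RtoC t * (z + y - x0))
  by (rewrite RtoC_minus; ring).
eapply Rle_lt_trans; [apply Cmod_triangle|].
rewrite !Cmod_mult, !Cmod_R, !Rabs_pos_eq by lra.
destruct (Req_dec t 0) as [->|N]; [lra|].
assert ((1 - t) * Cmod (z - x0) <= (1 - t) * B)%R by (apply Rmult_le_compat_l; lra).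
assert (t * Cmod (z + y - x0) < t * B)%R by (apply Rmult_lt_compat_l; lra).
lra.
Qed.

(** The limit is taken along one sequence tending to 0, and the hypothesis with [y'] on that
    sequence transfers it to every [y]. *)
Lemma Cauchy_limit_at_zero (phi : C -> C) (K d : R) : (0 < d)%R -> (0 <= K)%R ->
  (forall y y', (0 < Cmod y < d)%R -> (0 < Cmod y' < d)%R ->
     (Cmod (phi y - phi y') <= K * (Cmod y + Cmod y'))%R) ->
  exists L : C, forall y, (0 < Cmod y < d)%R -> (Cmod (phi y - L) <= K * Cmod y)%R.
Proof.
intros Hd HK H.
(* The 2 keeps the terms strictly inside the disc from [n = 0] on. *)
set (y := fun n : nat => RtoC (d / (INR n + 2))).
assert (Pn : forall n, (0 < INR n + 2)%R) by (intros n; pose proof (pos_INR n); lra).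
assert (Ey : forall n, Cmod (y n) = (d / (INR n + 2))%R).
{ intros n; unfold y; rewrite Cmod_R; apply Rabs_pos_eq, Rlt_le, Rdiv_lt_0_compat; auto. }
assert (Hy : forall n, (0 < Cmod (y n) < d)%R).
{ intros n; rewrite Ey; split; [apply Rdiv_lt_0_compat; auto|].
  apply (Rmult_lt_reg_r (INR n + 2)); [auto|].
  replace (d / (INR n + 2) * (INR n + 2))%R with d by (field; apply Rgt_not_eq, Pn).
  pose proof (pos_INR n); nra. }
assert (Lim : forall e, (0 < e)%R -> exists N, forall n, (N <= n)%nat -> (K * Cmod (y n) < e)%R).
{ intros e He; destruct (INR_archimed e (K * d)) as [N HN]; [exact He|].
  exists N; intros n Hn; rewrite Ey.
  apply (Rmult_lt_reg_r (INR n + 2)); [auto|].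
  replace (K * (d / (INR n + 2)) * (INR n + 2))%R with (K * d)%R
    by (field; apply Rgt_not_eq, Pn).
  apply le_INR in Hn; nra. }
destruct (proj1 (filterlim_locally_cauchy (U := C_CompleteNormedModule)
  (F := eventually) (fun n => phi (y n)))) as [L HL].
{ intros [e He].
  destruct (Lim (e / 2)%R ltac:(lra)) as [N HN].
  exists (fun n => (N <= n)%nat); split; [exists N; auto|].
  intros m n Hm Hn; apply (C_NormedModule_mixin_compat1 (phi (y m)) (phi (y n))).
  eapply Rle_lt_trans; [apply H; apply Hy|].
  specialize (HN m Hm) as H1; specialize (HN n Hn) as H2; simpl; lra. }
exists L; intros w Hw; apply le_epsilon; intros e He.
destruct (HL (fun v => (Cmod (v - L) < e / 2)%R)) as [N1 HN1].
{ apply (proj2 (locally_C_iff L _)); exists (e / 2)%R; split; [lra|auto]. }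
destruct (Lim (e / 2)%R ltac:(lra)) as [N2 HN2].
set (n := Nat.max N1 N2).
specialize (HN1 n (Nat.le_max_l _ _)); specialize (HN2 n (Nat.le_max_r _ _)).
pose proof (Cmod_sub_triangle (phi w) (phi (y n)) L).
pose proof (H w (y n) Hw (Hy n)).
lra.
Qed.

(** The quotients [q_y(w) = (f(w + y) - f(w)) / y] differ from [f'] by at most [L |y|], uniformly
    for [|w - z| <= r]. Cauchy's estimate for [q_y - q_y'] at [z] then shows that the difference
    quotients of [f'] at [z] satisfy the hypothesis of [Cauchy_limit_at_zero]. *)
Lemma ex_derive_C_derive (f : C -> C) (z : C) (R0 : R) : (0 < R0)%R ->
  (forall v, (Cmod (v - z) < R0)%R -> ex_derive f v) ->
  ex_derive (C_derive f) z.
Proof.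
intros HR Hf.
assert (Df : forall v, (Cmod (v - z) < R0)%R -> is_derive f v (C_derive f v)).
{ intros v Hv; apply is_derive_C_derive, Hf, Hv. }
destruct (proj1 (continuous_C_iff f z)) with (eps := 1%R) as [d [Hd Hb]]; [|lra|].
{ apply (is_derive_C_continuous f z (C_derive f z)), Df.
  replace (z - z) with (RtoC 0) by ring; rewrite Cmod_0; exact HR. }
(* Four nested discs: [f] is bounded on radius [4 r], [f'] on [3 r], [f'] is Lipschitz for small
   increments on [2 r], and the remainder of [f] is quadratic on [r]. *)
set (r := (Rmin R0 d / 4)%R).
assert (Hr : (0 < r)%R) by (unfold r; pose proof (Rmin_pos R0 d HR Hd); lra).
assert (HrR : (4 * r <= R0 /\ 4 * r <= d)%R).
{ unfold r; pose proof (Rmin_l R0 d); pose proof (Rmin_r R0 d); lra. }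
set (M := (Cmod (f z) + 1)%R).
assert (HM : (0 < M)%R) by (unfold M; pose proof (Cmod_ge_0 (f z)); lra).
assert (B0 : forall v, (Cmod (v - z) < 4 * r)%R -> (Cmod (f v) <= M)%R).
{ intros v Hv; specialize (Hb v ltac:(lra)); pose proof (Cmod_abs_sub (f v) (f z)).
  unfold M; lra. }
assert (B1 : forall v, (Cmod (v - z) < 3 * r)%R -> (Cmod (C_derive f v) <= M / r)%R).
{ intros v Hv; apply (Cauchy_estimate f v); [exact Hr| |apply Df; lra].
  intros w Hw; pose proof (Cmod_sub_triangle w v z).
  split; [apply Hf; lra|apply B0; lra]. }
assert (B2 : forall v y, (Cmod (v - z) < 3 * r)%R -> (Cmod (v + y - z) < 3 * r)%R ->
  (Cmod (f (v + y)%C - f v) <= M / r * Cmod y)%R).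
{ intros v y Hv Hvy; apply (Cmod_mean_value f (C_derive f)); intros t Ht.
  assert (S := Cmod_segment z v y t (3 * r) Ht Hv Hvy).
  split; [apply Df; lra|apply B1, S]. }
assert (Dshift : forall v y, (Cmod (v + y - z) < R0)%R ->
  is_derive (fun w => f (w + y)) v (C_derive f (v + y))).
{ intros v y Hv.
  replace (C_derive f (v + y)) with ((1 + 0) * C_derive f (v + y)) by ring.
  apply (is_derive_Ccomp f (fun w => w + y)); [apply Df, Hv|].
  apply is_derive_Cplus; [apply is_derive_Cid|apply is_derive_Cconst]. }
(* Cauchy's estimate with radius [r / 2], applied to the increment of [f], which [B2] bounds by
   [M / r * |y|]. *)
set (L := (M / r / (r / 2))%R).
assert (HL : (0 < L)%R) by (unfold L; apply Rdiv_lt_0_compat; [apply Rdiv_lt_0_compat|]; lra).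
assert (B3 : forall v y, (Cmod (v - z) < 2 * r)%R -> (Cmod y < r / 2)%R ->
  (Cmod (C_derive f (v + y)%C - C_derive f v) <= L * Cmod y)%R).
{ intros v y Hv Hy.
  pose proof (Cmod_triangle (v - z) y) as T.
  replace (v - z + y) with (v + y - z) in T by ring.
  replace (L * Cmod y)%R with (M / r * Cmod y / (r / 2))%R by (unfold L; field; lra).
  apply (Cauchy_estimate (fun w => f (w + y) - f w) v); [lra| |].
  - intros w Hw.
    pose proof (Cmod_sub_triangle w v z).
    pose proof (Cmod_triangle (w - z) y) as T'.
    replace (w - z + y) with (w + y - z) in T' by ring.
    split; [|apply B2; lra].
    eexists; apply is_derive_Cminus; [apply Dshift; lra|apply Df; lra].
  - apply is_derive_Cminus; [apply Dshift; lra|apply Df; lra]. }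
assert (B4 : forall v y, (Cmod (v - z) <= r)%R -> (Cmod y < r / 2)%R ->
  (Cmod (f (v + y)%C - f v - C_derive f v * y) <= L * Cmod y * Cmod y)%R).
{ intros v y Hv Hy.
  replace (f (v + y) - f v - C_derive f v * y)
    with ((f (v + y) - C_derive f v * (v + y)) - (f v - C_derive f v * v)) by ring.
  apply (Cmod_mean_value (fun w => f w - C_derive f v * w)
    (fun w => C_derive f w - C_derive f v * 1)).
  intros t Ht.
  assert (Hty : (Cmod (RtoC t * y) <= Cmod y)%R).
  { rewrite Cmod_mult, Cmod_R, Rabs_pos_eq by lra.
    pose proof (Cmod_ge_0 y); nra. }
  pose proof (Cmod_triangle (v - z) (RtoC t * y)) as T.
  replace (v - z + RtoC t * y) with (v + RtoC t * y - z) in T by ring.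
  split.
  - apply is_derive_Cminus; [apply Df; lra|apply is_derive_Cscal, is_derive_Cid].
  - rewrite Cmult_1_r.
    eapply Rle_trans; [apply B3; lra|].
    apply Rmult_le_compat_l; lra. }
destruct (Cauchy_limit_at_zero (fun y => (C_derive f (z + y) - C_derive f z) / y)
  (L / r) (r / 2)) as [l Hl]; [lra|apply Rlt_le, Rdiv_lt_0_compat; lra| |].
- intros y y' Hy Hy'.
  assert (Ny : y <> 0) by (apply Cmod_gt_0; lra).
  assert (Ny' : y' <> 0) by (apply Cmod_gt_0; lra).
  assert (Dq : forall u : C, u <> 0 -> (Cmod u < r / 2)%R -> forall w, (Cmod (w - z) <= r)%R ->
    is_derive (fun v => / u * (f (v + u) - f v)) w ((C_derive f (w + u) - C_derive f w) / u)).
  { intros u Hu Hu' w Hw.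
    replace ((C_derive f (w + u) - C_derive f w) / u)
      with (/ u * (C_derive f (w + u) - C_derive f w)) by (field; exact Hu).
    pose proof (Cmod_triangle (w - z) u) as T'.
    replace (w - z + u) with (w + u - z) in T' by ring.
    apply is_derive_Cscal, is_derive_Cminus; [apply Dshift; lra|apply Df; lra]. }
  assert (Bq : forall u : C, u <> 0 -> (Cmod u < r / 2)%R -> forall w, (Cmod (w - z) <= r)%R ->
    (Cmod (/ u * (f (w + u)%C - f w) - C_derive f w) <= L * Cmod u)%R).
  { intros u Hu Hu' w Hw.
    replace (/ u * (f (w + u) - f w) - C_derive f w)
      with ((f (w + u) - f w - C_derive f w * u) / u) by (field; exact Hu).
    rewrite Cmod_div by exact Hu.
    assert (Pu : (0 < Cmod u)%R) by (apply Cmod_gt_0, Hu).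
    apply (Rmult_le_reg_r (Cmod u)); [exact Pu|].
    unfold Rdiv; rewrite Rmult_assoc, Rinv_l, Rmult_1_r by lra.
    apply B4; assumption. }
  replace (L / r * (Cmod y + Cmod y'))%R with (L * (Cmod y + Cmod y') / r)%R by (field; lra).
  apply (Cauchy_estimate (fun w => / y * (f (w + y) - f w) - / y' * (f (w + y') - f w)) z);
    [lra| |].
  + intros w Hw; split.
    * eexists; apply is_derive_Cminus; [apply Dq with (u := y)|apply Dq with (u := y')];
        first [assumption|lra].
    * pose proof (Bq y Ny ltac:(lra) w Hw); pose proof (Bq y' Ny' ltac:(lra) w Hw).
      pose proof (Cmod_sub_triangle (/ y * (f (w + y) - f w)) (C_derive f w)
        (/ y' * (f (w + y') - f w))) as T.
      rewrite (Cmod_sub_sym (C_derive f w)) in T; lra.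
  + assert (Zz : (Cmod (z - z) <= r)%R)
      by (replace (z - z) with (RtoC 0) by ring; rewrite Cmod_0; lra).
    apply is_derive_Cminus; apply Dq; first [assumption|lra].
- exists l; apply (is_derive_C_quadratic _ _ _ (r / 2) (L / r)); [lra|].
  intros w Hw.
  destruct (Req_dec (Cmod (w - z)) 0) as [Z|Z].
  { assert (w - z = 0) by (apply Cmod_eq_0, Z).
    assert (w = z) by (replace w with (w - z + z) by ring; rewrite H; ring); subst w.
    replace (C_derive f z - C_derive f z - l * (z - z)) with (RtoC 0) by ring.
    rewrite Z, Cmod_0; lra. }
  pose proof (Cmod_ge_0 (w - z)).
  specialize (Hl (w - z) ltac:(lra)).
  replace (z + (w - z)) with w in Hl by ring.
  assert (N : w - z <> 0) by (apply Cmod_gt_0; lra).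
  replace (C_derive f w - C_derive f z - l * (w - z))
    with (((C_derive f w - C_derive f z) / (w - z) - l) * (w - z)) by (field; exact N).
  rewrite Cmod_mult; nra.
Qed.

Lemma Cauchy_estimate_disc (f : C -> C) (x0 z : C) (R0 r M : R) : (0 < r)%R ->
  (forall v, (Cmod (v - x0) < R0)%R -> ex_derive f v /\ (Cmod (f v) <= M)%R) ->
  (Cmod (z - x0) < R0 - r)%R -> (Cmod (C_derive f z) <= M / r)%R.
Proof.
intros Hr Hf Hz; apply (Cauchy_estimate f z); [exact Hr| |].
- intros v Hv; apply Hf; pose proof (Cmod_sub_triangle v z x0); lra.
- apply is_derive_C_derive, Hf; lra.
Qed.

(** The mean value inequality twice: for [f - f'(x) w], and for [f'] to bound the derivative of that
    difference. *)
Lemma Cmod_C_derive_Lipschitz_remainder (f : C -> C) (x0 : C) (R0 B : R) :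
  (forall v, (Cmod (v - x0) < R0)%R -> ex_derive f v /\
     ex_derive (C_derive f) v /\ (Cmod (C_derive (C_derive f) v) <= B)%R) ->
  forall x y, (Cmod (x - x0) < R0)%R -> (Cmod (x + y - x0) < R0)%R ->
  (Cmod (f (x + y)%C - f x - C_derive f x * y) <= B * Cmod y ^ 2)%R.
Proof.
intros Hf x y Hx Hy.
replace (f (x + y) - f x - C_derive f x * y)
  with ((f (x + y) - C_derive f x * (x + y)) - (f x - C_derive f x * x)) by ring.
replace (B * Cmod y ^ 2)%R with (B * Cmod y * Cmod y)%R by ring.
apply (Cmod_mean_value (fun w => f w - C_derive f x * w)
  (fun w => C_derive f w - C_derive f x * 1)).
intros t Ht.
assert (S := Cmod_segment x0 x y t R0 Ht Hx Hy).
split.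
- apply is_derive_Cminus; [apply is_derive_C_derive, Hf, S|apply is_derive_Cscal, is_derive_Cid].
- rewrite Cmult_1_r.
  assert (B0 : (0 <= B)%R).
  { eapply Rle_trans; [apply Cmod_ge_0|apply (Hf x Hx)]. }
  apply Rle_trans with (B * Cmod (RtoC t * y))%R.
  + apply (Cmod_mean_value (C_derive f) (C_derive (C_derive f))).
    intros s Hs.
    assert (S' := Cmod_segment x0 x (RtoC t * y) s R0 Hs Hx S).
    split; [apply is_derive_C_derive|]; apply Hf, S'.
  + apply Rmult_le_compat_l; [exact B0|].
    rewrite Cmod_mult, Cmod_R, Rabs_pos_eq by lra.
    pose proof (Cmod_ge_0 y); nra.
Qed.

Lemma ex_derive_C_derive_disc (f : C -> C) (x0 : C) (R0 : R) :
  (forall v, (Cmod (v - x0) < R0)%R -> ex_derive f v) ->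
  forall v, (Cmod (v - x0) < R0)%R -> ex_derive (C_derive f) v.
Proof.
intros Hf v Hv; apply (ex_derive_C_derive f v (R0 - Cmod (v - x0))); [lra|].
intros w Hw; apply Hf; pose proof (Cmod_sub_triangle w v x0); lra.
Qed.

(** Two Cauchy estimates bound [f''] by [M / r / r], each at the cost of [r] in the radius. *)
Lemma Taylor_remainder_disc (f : C -> C) (x0 : C) (R0 r M : R) : (0 < r)%R ->
  (forall v, (Cmod (v - x0) < R0)%R -> ex_derive f v /\ (Cmod (f v) <= M)%R) ->
  forall x y, (Cmod (x - x0) < R0 - 2 * r)%R -> (Cmod (x + y - x0) < R0 - 2 * r)%R ->
  (Cmod (f (x + y)%C - f x - C_derive f x * y) <= M / r / r * Cmod y ^ 2)%R.
Proof.
intros Hr Hf.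
assert (Hf' := ex_derive_C_derive_disc f x0 R0 (fun v Hv => proj1 (Hf v Hv))).
apply Cmod_C_derive_Lipschitz_remainder; intros v Hv.
refine (conj _ (conj _ _)); [apply Hf; lra|apply Hf'; lra|].
apply (Cauchy_estimate_disc (C_derive f) x0 v (R0 - r)); [exact Hr| |lra].
intros w Hw; split; [apply Hf'; lra|].
apply (Cauchy_estimate_disc f x0 w R0); assumption.
Qed.

(** * Differentiability in two variables *)

(** A differential with both partial derivatives explicit, measured by the sum of moduli; the
    product norm is equivalent to it, which [frechet_ex_filterdiff] exploits. *)
Definition frechet (F : C * C -> C) (p : C * C) (A B : C) : Prop :=
  forall eps : R, (0 < eps)%R -> exists d : R, (0 < d)%R /\ forall t x : C,
    (Cmod (t - fst p) < d)%R -> (Cmod (x - snd p) < d)%R ->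
    (Cmod (F (t, x) - F p - (A * (t - fst p) + B * (x - snd p)))
       <= eps * (Cmod (t - fst p) + Cmod (x - snd p)))%R.

Lemma frechet_ex_filterdiff (F : C * C -> C) (p : C * C) (A B : C) :
  frechet F p A B ->
  ex_filterdiff (K := C_AbsRing)
    (U := prod_NormedModule C_AbsRing C_NormedModule C_NormedModule)
    (V := C_NormedModule) F (locally p).
Proof.
intros H; exists (fun v : C * C => A * fst v + B * snd v).
set (U := prod_NormedModule C_AbsRing C_NormedModule C_NormedModule).
set (nv := fun v : C * C => norm (v : U)).
assert (N : forall v : C * C, (Cmod (fst v) <= nv v)%R /\ (Cmod (snd v) <= nv v)%R).
{ intros v; destruct (sqrt_plus_sqr (Cmod (fst v)) (Cmod (snd v))) as [S _].
  rewrite !Rabs_pos_eq in S by apply Cmod_ge_0.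
  change (nv v) with (sqrt (Cmod (fst v) ^ 2 + Cmod (snd v) ^ 2)).
  pose proof (Rmax_l (Cmod (fst v)) (Cmod (snd v))).
  pose proof (Rmax_r (Cmod (fst v)) (Cmod (snd v))); lra. }
assert (LN : forall a b : C,
  (Cmod (A * a + B * b) <= (Cmod A + Cmod B + 1) * nv (a, b))%R).
{ intros a b; destruct (N (a, b)) as [N1 N2]; simpl in N1, N2.
  eapply Rle_trans; [apply Cmod_triangle|]; rewrite !Cmod_mult.
  pose proof (Cmod_ge_0 a); pose proof (Cmod_ge_0 A); pose proof (Cmod_ge_0 B).
  assert (Cmod A * Cmod a <= Cmod A * nv (a, b))%R by (apply Rmult_le_compat_l; assumption).
  assert (Cmod B * Cmod b <= Cmod B * nv (a, b))%R by (apply Rmult_le_compat_l; assumption).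
  lra. }
split.
- split.
  + intros v w; change (A * (fst v + fst w) + B * (snd v + snd w) =
      A * fst v + B * snd v + (A * fst w + B * snd w)); ring.
  + intros k v; change (A * (k * fst v) + B * (k * snd v) = k * (A * fst v + B * snd v)); ring.
  + exists (Cmod A + Cmod B + 1)%R.
    pose proof (Cmod_ge_0 A); pose proof (Cmod_ge_0 B).
    split; [lra|]; intros [a b]; exact (LN a b).
- intros q Hq; rewrite <- (is_filter_lim_locally_unique (V := U) p q Hq); clear q Hq.
  intros [eps Heps].
  (* The sum of the two moduli is at most twice the product norm. *)
  destruct (H (eps / 2)%R ltac:(lra)) as [d [Hd Hw]].
  apply (locally_le_locally_norm (V := U) p); exists (mkposreal d Hd).
  intros [t x] Hb; destruct (N (minus ((t, x) : U) p)) as [N1 N2].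
  change (nv (minus ((t, x) : U) p) < d)%R in Hb.
  change (Cmod (t - fst p) <= nv (minus ((t, x) : U) p))%R in N1.
  change (Cmod (x - snd p) <= nv (minus ((t, x) : U) p))%R in N2.
  specialize (Hw t x ltac:(lra) ltac:(lra)).
  change (Cmod (F (t, x) - F p - (A * (t - fst p) + B * (x - snd p)))
    <= eps * nv (minus ((t, x) : U) p))%R.
  eapply Rle_trans; [exact Hw|].
  apply Rle_trans with (eps / 2 * (2 * nv (minus ((t, x) : U) p)))%R; [|lra].
  apply Rmult_le_compat_l; lra.
Qed.

Lemma frechet_quadratic (F : C * C -> C) (p : C * C) (A B : C) (d K : R) :
  (0 < d)%R ->
  (forall t x : C, (Cmod (t - fst p) < d)%R -> (Cmod (x - snd p) < d)%R ->
    (Cmod (F (t, x) - F p - (A * (t - fst p) + B * (x - snd p)))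
       <= K * (Cmod (t - fst p) + Cmod (x - snd p)) ^ 2)%R) ->
  frechet F p A B.
Proof.
intros Hd H eps Heps.
assert (HK : (0 < Rabs K + 1)%R) by (pose proof (Rabs_pos K); lra).
assert (Hq : (0 < eps / (Rabs K + 1))%R) by (apply Rdiv_lt_0_compat; assumption).
exists (Rmin d (eps / (Rabs K + 1) / 2)); split; [apply Rmin_pos; lra|].
intros t x Ht Hx.
pose proof (Rmin_l d (eps / (Rabs K + 1) / 2)); pose proof (Rmin_r d (eps / (Rabs K + 1) / 2)).
eapply Rle_trans; [apply H; lra|].
pose proof (Cmod_ge_0 (t - fst p)); pose proof (Cmod_ge_0 (x - snd p)).
set (m := (Cmod (t - fst p) + Cmod (x - snd p))%R) in *.
assert (Hm : (m * (Rabs K + 1) <= eps)%R).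
{ replace eps with (eps / (Rabs K + 1) * (Rabs K + 1))%R by (field; lra).
  apply Rmult_le_compat_r; [lra|unfold m; lra]. }
pose proof (Rle_abs K).
replace (K * m ^ 2)%R with (K * m * m)%R by ring.
apply Rmult_le_compat_r; [unfold m; lra|].
assert (0 <= m)%R by (unfold m; lra).
nra.
Qed.

Lemma frechet_ext (F G : C * C -> C) (p : C * C) (A B : C) :
  (forall q, F q = G q) -> frechet F p A B -> frechet G p A B.
Proof.
intros E H eps Heps; destruct (H eps Heps) as [d [Hd Hw]].
exists d; split; [exact Hd|]; intros t x; rewrite <- !E; apply Hw.
Qed.

Lemma frechet_dt (F : C * C -> C) (t x A B : C) :
  frechet F (t, x) A B -> is_derive (fun s => F (s, x)) t A.
Proof.
intros H; apply is_derive_C_iff; intros eps Heps.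
destruct (H eps Heps) as [d [Hd Hw]]; exists d; split; [exact Hd|].
intros s Hs; simpl in Hw.
assert (Z : Cmod (x - x) = 0%R) by (replace (x - x) with (RtoC 0) by ring; apply Cmod_0).
specialize (Hw s x Hs ltac:(lra)); rewrite Z, Rplus_0_r in Hw.
replace (A * (s - t) + B * (x - x)) with (A * (s - t)) in Hw by ring; exact Hw.
Qed.

Lemma frechet_dx (F : C * C -> C) (t x A B : C) :
  frechet F (t, x) A B -> is_derive (fun y => F (t, y)) x B.
Proof.
intros H; apply is_derive_C_iff; intros eps Heps.
destruct (H eps Heps) as [d [Hd Hw]]; exists d; split; [exact Hd|].
intros s Hs; simpl in Hw.
assert (Z : Cmod (t - t) = 0%R) by (replace (t - t) with (RtoC 0) by ring; apply Cmod_0).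
specialize (Hw t s ltac:(lra) Hs); rewrite Z, Rplus_0_l in Hw.
replace (A * (t - t) + B * (s - x)) with (B * (s - x)) in Hw by ring; exact Hw.
Qed.

Lemma frechet_Lipschitz (F : C * C -> C) (p : C * C) (A B : C) :
  frechet F p A B ->
  exists K d : R, (0 < K)%R /\ (0 < d)%R /\ forall t x : C,
    (Cmod (t - fst p) < d)%R -> (Cmod (x - snd p) < d)%R ->
    (Cmod (F (t, x) - F p) <= K * (Cmod (t - fst p) + Cmod (x - snd p)))%R.
Proof.
intros H; destruct (H 1%R Rlt_0_1) as [d [Hd Hw]].
pose proof (Cmod_ge_0 A); pose proof (Cmod_ge_0 B).
exists (Cmod A + Cmod B + 1)%R, d; split; [lra|split; [exact Hd|]].
intros t x Ht Hx; specialize (Hw t x Ht Hx).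
pose proof (Cmod_abs_sub (F (t, x) - F p) (A * (t - fst p) + B * (x - snd p))).
pose proof (Cmod_triangle (A * (t - fst p)) (B * (x - snd p))) as T.
rewrite !Cmod_mult in T.
pose proof (Cmod_ge_0 (t - fst p)); pose proof (Cmod_ge_0 (x - snd p)).
nra.
Qed.

Lemma frechet_comp (phi : C -> C) (F : C * C -> C) (p : C * C) (A B l : C) :
  is_derive phi (F p) l -> frechet F p A B ->
  frechet (fun q => phi (F q)) p (l * A) (l * B).
Proof.
intros Hphi HF eps Heps; rewrite is_derive_C_iff in Hphi.
destruct (frechet_Lipschitz F p A B HF) as [K [d1 [HK [Hd1 L]]]].
destruct (Hphi (eps / (2 * K))%R) as [d2 [Hd2 Hp]]; [apply Rdiv_lt_0_compat; lra|].
pose proof (Cmod_ge_0 l) as Pl.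
destruct (HF (eps / (2 * (Cmod l + 1)))%R) as [d3 [Hd3 Hf]]; [apply Rdiv_lt_0_compat; lra|].
assert (Hd4 : (0 < d2 / (2 * K))%R) by (apply Rdiv_lt_0_compat; lra).
exists (Rmin (Rmin d1 (d2 / (2 * K))) d3); split; [repeat apply Rmin_pos; assumption|].
intros t x Ht Hx.
pose proof (Rmin_l (Rmin d1 (d2 / (2 * K))) d3) as M1.
pose proof (Rmin_r (Rmin d1 (d2 / (2 * K))) d3) as M2.
pose proof (Rmin_l d1 (d2 / (2 * K))) as M3; pose proof (Rmin_r d1 (d2 / (2 * K))) as M4.
specialize (L t x ltac:(lra) ltac:(lra)); specialize (Hf t x ltac:(lra) ltac:(lra)).
pose proof (Cmod_ge_0 (t - fst p)); pose proof (Cmod_ge_0 (x - snd p)).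
set (m := (Cmod (t - fst p) + Cmod (x - snd p))%R) in *.
assert (Hm : (K * m < d2)%R).
{ replace d2 with (K * (2 * (d2 / (2 * K))))%R by (field; lra).
  apply Rmult_lt_compat_l; [exact HK|unfold m; lra]. }
specialize (Hp (F (t, x)) ltac:(lra)).
replace (phi (F (t, x)) - phi (F p) - (l * A * (t - fst p) + l * B * (x - snd p)))
  with ((phi (F (t, x)) - phi (F p) - l * (F (t, x) - F p)) +
     l * (F (t, x) - F p - (A * (t - fst p) + B * (x - snd p)))) by ring.
eapply Rle_trans; [apply Cmod_triangle|].
rewrite (Cmod_mult l).
assert (E1 : (eps / (2 * K) * Cmod (F (t, x) - F p) <= eps / 2 * m)%R).
{ replace (eps / 2 * m)%R with (eps / (2 * K) * (K * m))%R by (field; lra).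
  apply Rmult_le_compat_l; [apply Rlt_le, Rdiv_lt_0_compat; lra|exact L]. }
assert (E2 : (Cmod l * Cmod (F (t, x) - F p - (A * (t - fst p) + B * (x - snd p)))
    <= eps / 2 * m)%R).
{ replace (eps / 2 * m)%R with ((Cmod l + 1) * (eps / (2 * (Cmod l + 1)) * m))%R by (field; lra).
  apply Rmult_le_compat; try apply Cmod_ge_0; [lra|exact Hf]. }
lra.
Qed.

Lemma frechet_lin (c1 c2 : C) (F G : C * C -> C) (p : C * C) (A B A' B' : C) :
  frechet F p A B -> frechet G p A' B' ->
  frechet (fun q => c1 * F q + c2 * G q) p (c1 * A + c2 * A') (c1 * B + c2 * B').
Proof.
intros HF HG eps Heps.
pose proof (Cmod_ge_0 c1); pose proof (Cmod_ge_0 c2).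
set (k := (Cmod c1 + Cmod c2 + 1)%R).
assert (Hk : (0 < k)%R) by (unfold k; lra).
assert (He : (0 < eps / k)%R) by (apply Rdiv_lt_0_compat; lra).
destruct (HF _ He) as [d1 [Hd1 H1]]; destruct (HG _ He) as [d2 [Hd2 H2]].
exists (Rmin d1 d2); split; [apply Rmin_pos; assumption|].
intros t x Ht Hx; pose proof (Rmin_l d1 d2); pose proof (Rmin_r d1 d2).
specialize (H1 t x ltac:(lra) ltac:(lra)); specialize (H2 t x ltac:(lra) ltac:(lra)).
replace (c1 * F (t, x) + c2 * G (t, x) - (c1 * F p + c2 * G p) -
   ((c1 * A + c2 * A') * (t - fst p) + (c1 * B + c2 * B') * (x - snd p)))
  with (c1 * (F (t, x) - F p - (A * (t - fst p) + B * (x - snd p))) +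
        c2 * (G (t, x) - G p - (A' * (t - fst p) + B' * (x - snd p)))) by ring.
eapply Rle_trans; [apply Cmod_triangle|]; rewrite !Cmod_mult.
pose proof (Cmod_ge_0 (t - fst p)); pose proof (Cmod_ge_0 (x - snd p)).
set (m := (Cmod (t - fst p) + Cmod (x - snd p))%R) in *.
assert (0 <= eps / k * m)%R by (apply Rmult_le_pos; unfold m; lra).
apply Rle_trans with ((Cmod c1 + Cmod c2) * (eps / k * m))%R.
- rewrite Rmult_plus_distr_r; apply Rplus_le_compat; apply Rmult_le_compat_l; assumption.
- replace (eps * m)%R with (k * (eps / k * m))%R by (field; lra).
  apply Rmult_le_compat_r; [assumption|unfold k; lra].
Qed.

Lemma is_derive_Csqr (z : C) : is_derive (fun w => w * w) z (2 * z).
Proof.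
replace (2 * z) with (1 * z + z * 1) by ring.
apply (is_derive_Cmult (fun w => w) (fun w => w)); apply is_derive_Cid.
Qed.

Lemma frechet_mult (F G : C * C -> C) (p : C * C) (A B A' B' : C) :
  frechet F p A B -> frechet G p A' B' ->
  frechet (fun q => F q * G q) p (A * G p + F p * A') (B * G p + F p * B').
Proof.
intros HF HG.
(* Polarization: 4 F G = (F + G)^2 - (F - G)^2. *)
assert (S := frechet_lin 1 1 F G p _ _ _ _ HF HG).
assert (D := frechet_lin 1 (- (1)) F G p _ _ _ _ HF HG).
apply (frechet_comp _ _ _ _ _ _ (is_derive_Csqr _)) in S.
apply (frechet_comp _ _ _ _ _ _ (is_derive_Csqr _)) in D.
assert (L := frechet_lin (1 / 4) (- (1 / 4)) _ _ p _ _ _ _ S D); cbv beta in L.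
match type of L with frechet _ _ ?a ?b =>
  replace a with (A * G p + F p * A') in L by field;
  replace b with (B * G p + F p * B') in L by field end.
revert L; apply frechet_ext; intros q; field.
Qed.

Lemma frechet_div (F G : C * C -> C) (p : C * C) (A B A' B' : C) : G p <> 0 ->
  frechet F p A B -> frechet G p A' B' ->
  exists A'' B'', frechet (fun q => F q / G q) p A'' B''.
Proof.
intros HG0 HF HG; do 2 eexists.
apply (frechet_mult F (fun q => / G q)); [exact HF|].
apply (frechet_comp Cinv); [apply is_derive_Cinv, HG0|exact HG].
Qed.

(** Returns from the straightened variable [s = t - xi(x)] to t. The extra term [- A * l] is what
    later removes the drift [xi' chi_s]. *)
Lemma frechet_shift (F : C * C -> C) (xi : C -> C) (t x A B l : C) :
  frechet F (t - xi x, x) A B -> is_derive xi x l ->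
  frechet (fun q => F (fst q - xi (snd q), snd q)) (t, x) A (B - A * l).
Proof.
intros HF Hxi eps Heps; rewrite is_derive_C_iff in Hxi.
pose proof (Cmod_ge_0 l) as Pl; pose proof (Cmod_ge_0 A) as PA.
destruct (HF (eps / (2 * (Cmod l + 2)))%R) as [d1 [Hd1 H1]]; [apply Rdiv_lt_0_compat; lra|].
(* The 1 gives [xi] the Lipschitz constant [|l| + 1]; the other entry makes its remainder small
   after multiplication by [A]. *)
destruct (Hxi (Rmin 1 (eps / (2 * (Cmod A + 1))))%R) as [d2 [Hd2 H2]].
{ apply Rmin_pos; [lra|apply Rdiv_lt_0_compat; lra]. }
assert (Hd3 : (0 < d1 / (Cmod l + 2))%R) by (apply Rdiv_lt_0_compat; lra).
exists (Rmin d2 (d1 / (Cmod l + 2))); split; [apply Rmin_pos; assumption|].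
simpl; intros t' x' Ht Hx.
pose proof (Rmin_l d2 (d1 / (Cmod l + 2))) as M1.
pose proof (Rmin_r d2 (d1 / (Cmod l + 2))) as M2.
pose proof (Cmod_ge_0 (t' - t)); pose proof (Cmod_ge_0 (x' - x)).
specialize (H2 x' ltac:(lra)).
assert (H3 : (Cmod (xi x' - xi x - l * (x' - x)) <= 1 * Cmod (x' - x))%R).
{ eapply Rle_trans; [exact H2|]; apply Rmult_le_compat_r; [assumption|apply Rmin_l]. }
assert (H4 : (Cmod (xi x' - xi x - l * (x' - x)) <= eps / (2 * (Cmod A + 1)) * Cmod (x' - x))%R).
{ eapply Rle_trans; [exact H2|]; apply Rmult_le_compat_r; [assumption|apply Rmin_r]. }
assert (H5 : (Cmod (t' - xi x' - (t - xi x)) <= Cmod (t' - t) + (Cmod l + 1) * Cmod (x' - x))%R).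
{ replace (t' - xi x' - (t - xi x))
    with (t' - t + - ((xi x' - xi x - l * (x' - x)) + l * (x' - x))) by ring.
  eapply Rle_trans; [apply Cmod_triangle|]; rewrite Cmod_opp.
  pose proof (Cmod_triangle (xi x' - xi x - l * (x' - x)) (l * (x' - x))) as T.
  rewrite (Cmod_mult l) in T; lra. }
assert (Ed : (d1 = (Cmod l + 2) * (d1 / (Cmod l + 2)))%R) by (field; lra).
assert (H6 : (Cmod (t' - xi x' - (t - xi x)) < d1)%R) by nra.
assert (H7 : (Cmod (x' - x) < d1)%R) by nra.
specialize (H1 (t' - xi x') x' H6 H7); simpl in H1.
replace (F (t' - xi x', x') - F (t - xi x, x) - (A * (t' - t) + (B - A * l) * (x' - x)))
  with ((F (t' - xi x', x') - F (t - xi x, x) -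
     (A * (t' - xi x' - (t - xi x)) + B * (x' - x))) +
     - (A * (xi x' - xi x - l * (x' - x)))) by ring.
eapply Rle_trans; [apply Cmod_triangle|]; rewrite Cmod_opp, (Cmod_mult A).
assert (E1 : (Cmod A * Cmod (xi x' - xi x - l * (x' - x))
    <= (Cmod A + 1) * (eps / (2 * (Cmod A + 1)) * Cmod (x' - x)))%R).
{ apply Rmult_le_compat; try apply Cmod_ge_0; [lra|exact H4]. }
replace ((Cmod A + 1) * (eps / (2 * (Cmod A + 1)) * Cmod (x' - x)))%R
  with (eps / 2 * Cmod (x' - x))%R in E1 by (field; lra).
assert (E2 : (eps / (2 * (Cmod l + 2)) * (Cmod (t' - xi x' - (t - xi x)) + Cmod (x' - x))
    <= eps / 2 * (Cmod (t' - t) + Cmod (x' - x)))%R).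
{ replace (eps / 2 * (Cmod (t' - t) + Cmod (x' - x)))%R
    with (eps / (2 * (Cmod l + 2)) * ((Cmod l + 2) * (Cmod (t' - t) + Cmod (x' - x))))%R
    by (field; lra).
  apply Rmult_le_compat_l; [apply Rlt_le, Rdiv_lt_0_compat; lra|nra]. }
nra.
Qed.

(** * Series of complex numbers *)

Definition is_Cseries (a : nat -> C) (s : C) : Prop :=
  is_series (fun n => Re (a n)) (Re s) /\ is_series (fun n => Im (a n)) (Im s).

Definition Cseries (a : nat -> C) : C :=
  (Series (fun n => Re (a n)), Series (fun n => Im (a n))).

Lemma is_Cseries_unique (a : nat -> C) (s : C) : is_Cseries a s -> Cseries a = s.
Proof.
intros [H1 H2]; unfold Cseries.
rewrite (is_series_unique _ _ H1), (is_series_unique _ _ H2).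
symmetry; apply surjective_pairing.
Qed.

Lemma im_le_Cmod (c : C) : (Rabs (Im c) <= Cmod c)%R.
Proof. eapply Rle_trans; [apply Rmax_r|apply (Rmax_Cmod c)]. Qed.

Lemma Cseries_correct (a : nat -> C) (b : nat -> R) :
  (forall n, (Cmod (a n) <= b n)%R) -> ex_series b -> is_Cseries a (Cseries a).
Proof.
intros H Hb; split; apply Series_correct;
  apply (ex_series_le (V := R_CompleteNormedModule) _ b); try exact Hb; intros n;
  (eapply Rle_trans; [|apply H]).
- apply re_le_Cmod.
- apply im_le_Cmod.
Qed.

Lemma is_Cseries_ext (a b : nat -> C) (s : C) :
  (forall n, a n = b n) -> is_Cseries a s -> is_Cseries b s.
Proof.
intros E [H1 H2]; split;
  [revert H1|revert H2]; apply is_series_ext; intros n; rewrite E; reflexivity.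
Qed.

Lemma is_Cseries_plus (a b : nat -> C) (s t : C) :
  is_Cseries a s -> is_Cseries b t -> is_Cseries (fun n => a n + b n) (s + t).
Proof.
intros [H1 H2] [H3 H4]; split.
- exact (is_series_plus _ _ _ _ H1 H3).
- exact (is_series_plus _ _ _ _ H2 H4).
Qed.

Lemma is_Cseries_scal (c : C) (a : nat -> C) (s : C) :
  is_Cseries a s -> is_Cseries (fun n => c * a n) (c * s).
Proof.
intros [H1 H2]; split.
- exact (is_series_minus _ _ _ _ (is_series_scal (V := R_NormedModule) (fst c) _ _ H1)
    (is_series_scal (V := R_NormedModule) (snd c) _ _ H2)).
- exact (is_series_plus _ _ _ _ (is_series_scal (V := R_NormedModule) (fst c) _ _ H2)
    (is_series_scal (V := R_NormedModule) (snd c) _ _ H1)).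
Qed.

Lemma is_Cseries_minus (a b : nat -> C) (s t : C) :
  is_Cseries a s -> is_Cseries b t -> is_Cseries (fun n => a n - b n) (s - t).
Proof.
intros H1 H2; apply (is_Cseries_scal (- (1))) in H2.
assert (H := is_Cseries_plus _ _ _ _ H1 H2).
replace (s - t) with (s + - (1) * t) by ring.
revert H; apply is_Cseries_ext; intros n; ring.
Qed.

Lemma is_Cseries_decr_1 (a : nat -> C) (s : C) :
  is_Cseries (fun n => a (S n)) s -> is_Cseries a (a 0%nat + s).
Proof.
intros [H1 H2]; split; apply is_series_decr_1.
- match goal with |- is_series _ ?l => replace l with (Re s); [exact H1|] end.
  change (Re s = Re (a 0%nat) + Re s + - Re (a 0%nat))%R; ring.
- match goal with |- is_series _ ?l => replace l with (Im s); [exact H2|] end.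
  change (Im s = Im (a 0%nat) + Im s + - Im (a 0%nat))%R; ring.
Qed.

Lemma is_series_le (a b : nat -> R) (s t : R) :
  (forall n, a n <= b n)%R -> is_series a s -> is_series b t -> (s <= t)%R.
Proof.
intros H Ha Hb.
apply (is_lim_seq_le (sum_n a) (sum_n b) s t); [|exact Ha|exact Hb].
intros n; apply sum_n_m_le, H.
Qed.

(** Pairing with the conjugate of [s], as in [Cmod_mean_value], turns the sum into the real number
    [|s|^2] and each term into one of size at most [|s| b_n]. *)
Lemma Cmod_is_Cseries_le (a : nat -> C) (b : nat -> R) (s : C) (t : R) :
  (forall n, (Cmod (a n) <= b n)%R) -> is_Cseries a s -> is_series b t ->
  (Cmod s <= t)%R.
Proof.
intros H Ha Hb.
destruct (is_Cseries_scal (Cconj s) _ _ Ha) as [Hs _].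
assert (L : (Re (Cconj s * s) <= Cmod s * t)%R).
{ refine (is_series_le _ _ _ _ _ Hs (is_series_scal (V := R_NormedModule) (Cmod s) _ _ Hb)).
  intros n; eapply Rle_trans; [apply Rle_abs|].
  eapply Rle_trans; [apply re_le_Cmod|].
  rewrite Cmod_mult, Cmod_conj.
  apply (Rmult_le_compat_l (Cmod s)); [apply Cmod_ge_0|apply H]. }
assert (E : Re (Cconj s * s) = (Cmod s * Cmod s)%R).
{ replace (Cmod s * Cmod s)%R with (Cmod s ^ 2)%R by ring.
  rewrite Cmod2_alt; unfold Re, Im; simpl; ring. }
rewrite E in L.
destruct (Req_dec (Cmod s) 0) as [Z|Z].
- rewrite Z; apply (is_series_le (fun n => 0 * b n)%R b); [| |exact Hb].
  + intros n; rewrite Rmult_0_l; eapply Rle_trans; [apply Cmod_ge_0|apply H].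
  + replace (is_series (fun n => 0 * b n)%R 0%R) with (is_series (fun n => 0 * b n)%R (0 * t)%R)
      by (rewrite Rmult_0_l; reflexivity).
    exact (is_series_scal (V := R_NormedModule) 0%R _ _ Hb).
- pose proof (Cmod_ge_0 s); apply (Rmult_le_reg_l (Cmod s)); [lra|exact L].
Qed.

(** * Power series with holomorphic coefficients *)

(** The constants are explicit parameters because differentiation changes them: in [s] it doubles
    [K], in [x] it halves the disc. *)
Record geometric_coeffs (x0 : C) (R0 M K : R) (b : nat -> C -> C) : Prop := {
  gc_R : (0 < R0)%R;
  gc_M : (0 <= M)%R;
  gc_K : (0 < K)%R;
  gc_ex : forall n v, (Cmod (v - x0) < R0)%R -> ex_derive (b n) v;
  gc_le : forall n v, (Cmod (v - x0) < R0)%R -> (Cmod (b n v) <= M * K ^ n)%R }.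

Definition power_sum (b : nat -> C -> C) (q : C * C) : C :=
  Cseries (fun n => b n (snd q) * fst q ^ n).

Definition coeffs_ds (b : nat -> C -> C) (n : nat) (x : C) : C := INR (S n) * b (S n) x.

Definition coeffs_dx (b : nat -> C -> C) (n : nat) : C -> C := C_derive (b n).

Lemma geometric_series_half (M : R) :
  is_series (fun n => M * (1 / 2) ^ n)%R (2 * M)%R.
Proof.
replace (2 * M)%R with (scal M (/ (1 - 1 / 2)))%R
  by (unfold scal; simpl; unfold mult; simpl; field).
apply (is_series_scal (V := R_NormedModule)), is_series_geom.
rewrite Rabs_pos_eq; lra.
Qed.

(** Half of the radius [1 / K] already gives the ratio 1/2 and one majorant for all points. *)
Lemma geometric_coeffs_term (x0 : C) (R0 M K : R) (b : nat -> C -> C) (s x : C) (n : nat) :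
  geometric_coeffs x0 R0 M K b -> (Cmod s < / (2 * K))%R -> (Cmod (x - x0) < R0)%R ->
  (Cmod (b n x * s ^ n) <= M * (1 / 2) ^ n)%R.
Proof.
intros H Hs Hx; assert (HK := gc_K _ _ _ _ _ H); assert (HM := gc_M _ _ _ _ _ H).
rewrite Cmod_mult, Cmod_pow.
apply Rle_trans with (M * K ^ n * (/ (2 * K)) ^ n)%R.
- apply Rmult_le_compat; try apply Cmod_ge_0; [apply pow_le, Cmod_ge_0|apply H, Hx|].
  apply pow_incr; split; [apply Cmod_ge_0|lra].
- rewrite Rmult_assoc, <- Rpow_mult_distr.
  replace (K * / (2 * K))%R with (1 / 2)%R by (field; lra). lra.
Qed.

Lemma power_sum_correct (x0 : C) (R0 M K : R) (b : nat -> C -> C) (s x : C) :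
  geometric_coeffs x0 R0 M K b -> (Cmod s < / (2 * K))%R -> (Cmod (x - x0) < R0)%R ->
  is_Cseries (fun n => b n x * s ^ n) (power_sum b (s, x)).
Proof.
intros H Hs Hx; apply (Cseries_correct _ (fun n => M * (1 / 2) ^ n)%R).
- intros n; apply (geometric_coeffs_term x0 R0 M K b); assumption.
- exists (2 * M)%R; apply geometric_series_half.
Qed.

Lemma INR_S_le_pow2 (n : nat) : (INR (S n) <= 2 ^ n)%R.
Proof.
induction n as [|n IH]; [simpl; lra|].
rewrite S_INR; replace (2 ^ S n)%R with (2 ^ n + 2 ^ n)%R by (simpl; ring).
assert (1 <= 2 ^ n)%R by (apply pow_R1_Rle; lra). lra.
Qed.

(** The factor [n + 1 <= 2^n] is absorbed by doubling [K]. *)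
Lemma geometric_coeffs_ds (x0 : C) (R0 M K : R) (b : nat -> C -> C) :
  geometric_coeffs x0 R0 M K b -> geometric_coeffs x0 R0 (M * K) (2 * K) (coeffs_ds b).
Proof.
intros [H1 H2 H3 H4 H5]; split; [exact H1|nra|lra| |].
- intros n v Hv; destruct (H4 (S n) v Hv) as [l Hl].
  exists (INR (S n) * l); apply is_derive_Cscal, Hl.
- intros n v Hv; unfold coeffs_ds.
  rewrite Cmod_mult, Cmod_R, Rabs_pos_eq by apply pos_INR.
  rewrite Rpow_mult_distr.
  replace (M * K * (2 ^ n * K ^ n))%R with (2 ^ n * (M * K ^ S n))%R by (simpl; ring).
  apply Rmult_le_compat; [apply pos_INR|apply Cmod_ge_0|apply INR_S_le_pow2|apply H5, Hv].
Qed.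

Lemma geometric_coeffs_dx (x0 : C) (R0 M K : R) (b : nat -> C -> C) :
  geometric_coeffs x0 R0 M K b ->
  geometric_coeffs x0 (R0 / 2) (M / (R0 / 2)) K (coeffs_dx b).
Proof.
intros [H1 H2 H3 H4 H5]; split; [lra| |exact H3| |].
- apply Rmult_le_pos; [exact H2|apply Rlt_le, Rinv_0_lt_compat; lra].
- intros n v Hv; apply (ex_derive_C_derive_disc (b n) x0 R0); [intros w; apply H4|lra].
- intros n v Hv.
  replace (M / (R0 / 2) * K ^ n)%R with (M * K ^ n / (R0 / 2))%R by (field; lra).
  apply (Cauchy_estimate_disc (b n) x0 v R0); [lra| |lra].
  intros w Hw; split; [apply H4|apply H5]; exact Hw.
Qed.

Definition Cpow_derive (n : nat) (s : C) : C :=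
  match n with O => 0 | S k => INR (S k) * s ^ k end.

Lemma is_derive_Cpow_derive (n : nat) (s : C) :
  is_derive (fun w => w ^ n) s (Cpow_derive n s).
Proof. destruct n; [exact (is_derive_Cconst 1 s)|apply is_derive_Cpow]. Qed.

Lemma power_sum_ds_correct (x0 : C) (R0 M K : R) (b : nat -> C -> C) (s x : C) :
  geometric_coeffs x0 R0 M K b -> (Cmod s < / (4 * K))%R -> (Cmod (x - x0) < R0)%R ->
  is_Cseries (fun n => b n x * Cpow_derive n s) (power_sum (coeffs_ds b) (s, x)).
Proof.
intros H Hs Hx.
replace (power_sum (coeffs_ds b) (s, x))
  with (b 0%nat x * Cpow_derive 0 s + power_sum (coeffs_ds b) (s, x)) by (simpl; ring).
apply (is_Cseries_decr_1 (fun n => b n x * Cpow_derive n s)).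
apply (is_Cseries_ext (fun n => coeffs_ds b n x * s ^ n)).
- intros n; unfold coeffs_ds, Cpow_derive; ring.
- apply (power_sum_correct x0 R0 (M * K) (2 * K)); [apply geometric_coeffs_ds, H| |exact Hx].
  replace (2 * (2 * K))%R with (4 * K)%R by ring; exact Hs.
Qed.

(** The remainder of each term is quadratic in the increments, with a constant proportional to
    [(1/2)^n]; summing these gives a quadratic remainder for the series. *)
Lemma frechet_power_sum (x0 : C) (R0 M K : R) (b : nat -> C -> C) (s x : C) :
  geometric_coeffs x0 R0 M K b -> (Cmod s < / (4 * K))%R -> (Cmod (x - x0) < R0 / 2)%R ->
  frechet (power_sum b) (s, x)
    (power_sum (coeffs_ds b) (s, x)) (power_sum (coeffs_dx b) (s, x)).
Proof.
intros H Hs Hx.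
assert (HR := gc_R _ _ _ _ _ H); assert (HK := gc_K _ _ _ _ _ H).
assert (HM := gc_M _ _ _ _ _ H).
set (tau := (/ (2 * K))%R).
assert (Htau : (0 < tau)%R) by (apply Rinv_0_lt_compat; lra).
assert (Etau : (/ (4 * K) = tau / 2)%R) by (unfold tau; field; lra).
rewrite Etau in Hs.
(* Second order Taylor bounds lose twice these radii, which leaves [|s| < tau / 2] and
   [|x - x0| < R0 / 2]. *)
set (r := (tau / 4)%R); set (rho := (R0 / 4)%R).
assert (Hr : (0 < r)%R) by (unfold r; lra); assert (Hrho : (0 < rho)%R) by (unfold rho; lra).
set (k := (/ r + / rho)%R).
assert (Hk1 : (0 < / r)%R) by (apply Rinv_0_lt_compat, Hr).
assert (Hk2 : (0 < / rho)%R) by (apply Rinv_0_lt_compat, Hrho).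
set (d := (Rmin (tau / 2 - Cmod s) (R0 / 2 - Cmod (x - x0)))%R).
assert (Hd : (0 < d)%R) by (apply Rmin_pos; lra).
apply (frechet_quadratic _ _ _ _ d (2 * (M * k ^ 2))); [exact Hd|].
simpl fst; simpl snd; intros s' x' Hs' Hx'.
set (u := s' - s) in *; set (y := x' - x) in *.
assert (Es : s' = s + u) by (unfold u; ring).
assert (Ex : x' = x + y) by (unfold y; ring).
pose proof (Rmin_l (tau / 2 - Cmod s) (R0 / 2 - Cmod (x - x0))) as D1.
pose proof (Rmin_r (tau / 2 - Cmod s) (R0 / 2 - Cmod (x - x0))) as D2.
fold d in D1, D2.
assert (Bs : (Cmod (s + u) < tau / 2)%R) by (pose proof (Cmod_triangle s u); lra).
assert (Bx : (Cmod (x + y - x0) < R0 / 2)%R).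
{ pose proof (Cmod_triangle (x - x0) y) as T.
  replace (x - x0 + y) with (x + y - x0) in T by ring; lra. }
rewrite Es, Ex.
assert (S1 := power_sum_correct x0 R0 M K b (s + u) (x + y) H
  ltac:(fold tau; lra) ltac:(lra)).
assert (S2 := power_sum_correct x0 R0 M K b s x H ltac:(fold tau; lra) ltac:(lra)).
assert (S3 := power_sum_ds_correct x0 R0 M K b s x H ltac:(lra) ltac:(lra)).
assert (S4 := power_sum_correct _ _ _ _ _ s x (geometric_coeffs_dx x0 R0 M K b H)
  ltac:(fold tau; lra) ltac:(lra)).
assert (S5 := is_Cseries_minus _ _ _ _ (is_Cseries_minus _ _ _ _ S1 S2)
  (is_Cseries_plus _ _ _ _ (is_Cseries_scal u _ _ S3) (is_Cseries_scal y _ _ S4))).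
cbv beta in S5.
set (m := (Cmod u + Cmod y)%R).
replace (2 * (M * k ^ 2) * m ^ 2)%R with (2 * (M * (k * m) ^ 2))%R by ring.
replace (power_sum (coeffs_ds b) (s, x) * u + power_sum (coeffs_dx b) (s, x) * y)
  with (u * power_sum (coeffs_ds b) (s, x) + y * power_sum (coeffs_dx b) (s, x)) by ring.
refine (Cmod_is_Cseries_le _ _ _ _ _ S5 (geometric_series_half _)).
intros n; clear S1 S2 S3 S4 S5.
(* [T] bounds the powers and [B] the coefficients on the large discs; [tau K = 1/2] makes the
   product geometric. *)
set (T := (tau ^ n)%R); set (B := (M * K ^ n)%R).
assert (HT : (0 <= T)%R) by (apply pow_le; lra).
assert (HB : (0 <= B)%R) by (apply Rmult_le_pos; [exact HM|apply pow_le; lra]).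
assert (TB : (T * B = M * (1 / 2) ^ n)%R).
{ unfold T, B; replace (1 / 2)%R with (tau * K)%R by (unfold tau; field; lra).
  rewrite Rpow_mult_distr; ring. }
assert (Pn : forall v, (Cmod (v - 0) < tau)%R ->
  ex_derive (fun w => w ^ n) v /\ (Cmod (v ^ n) <= T)%R).
{ intros v Hv; split; [exists (Cpow_derive n v); apply is_derive_Cpow_derive|].
  rewrite Cmod_pow; apply pow_incr; split; [apply Cmod_ge_0|].
  replace (v - 0) with v in Hv by ring; lra. }
assert (Bn : forall v, (Cmod (v - x0) < R0)%R ->
  ex_derive (b n) v /\ (Cmod (b n v) <= B)%R).
{ intros v Hv; split; [apply H|apply H]; exact Hv. }
assert (DP : C_derive (fun w => w ^ n) s = Cpow_derive n s)
  by (apply is_C_derive_unique, is_derive_Cpow_derive).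
assert (Z : forall v : C, v - 0 = v) by (intros v; ring).
assert (P1 := Taylor_remainder_disc (fun w => w ^ n) 0 tau r T Hr Pn s u).
rewrite !Z, DP in P1.
specialize (P1 ltac:(unfold r; lra) ltac:(unfold r; lra)).
assert (P2 := Cauchy_estimate_disc (fun w => w ^ n) 0 s tau r T Hr Pn).
rewrite !Z, DP in P2; specialize (P2 ltac:(unfold r; lra)).
assert (P3 : (Cmod (s ^ n) <= T)%R) by (apply Pn; rewrite Z; lra).
assert (Q1 := Taylor_remainder_disc (b n) x0 R0 rho B Hrho Bn x y
  ltac:(unfold rho; lra) ltac:(unfold rho; lra)).
assert (Q3 : (Cmod (b n (x + y)%C) <= B)%R) by (apply Bn; lra).
assert (Q2 : (Cmod (b n (x + y)%C - b n x) <= B / rho * Cmod y)%R).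
{ apply (Cmod_mean_value (b n) (C_derive (b n))); intros t Ht.
  assert (Sg := Cmod_segment x0 x y t (R0 / 2) Ht Hx Bx).
  split; [apply is_derive_C_derive, Bn; lra|].
  apply (Cauchy_estimate_disc (b n) x0 _ R0); [exact Hrho|exact Bn|unfold rho; lra]. }
unfold coeffs_dx.
replace (b n (x + y) * (s + u) ^ n - b n x * s ^ n -
   (u * (b n x * Cpow_derive n s) + y * (C_derive (b n) x * s ^ n)))
  with (((s + u) ^ n - s ^ n - Cpow_derive n s * u) * b n (x + y) +
    (Cpow_derive n s * u * (b n (x + y) - b n x) +
     s ^ n * (b n (x + y) - b n x - C_derive (b n) x * y))) by ring.
eapply Rle_trans; [apply Cmod_triangle|].
eapply Rle_trans; [apply Rplus_le_compat_l, Cmod_triangle|].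
rewrite !(Cmod_mult (_ - _)), !(Cmod_mult (_ * _)), (Cmod_mult (Cpow_derive n s)), (Cmod_mult (s ^ n)).
pose proof (Cmod_ge_0 u); pose proof (Cmod_ge_0 y).
assert (F1 : (Cmod ((s + u) ^ n - s ^ n - Cpow_derive n s * u) * Cmod (b n (x + y)%C)
   <= T / r / r * Cmod u ^ 2 * B)%R).
{ apply Rmult_le_compat; try apply Cmod_ge_0; assumption. }
assert (F2 : (Cmod (Cpow_derive n s) * Cmod u * Cmod (b n (x + y)%C - b n x)
   <= T / r * Cmod u * (B / rho * Cmod y))%R).
{ apply Rmult_le_compat; try apply Cmod_ge_0; [|apply Rmult_le_compat_r; assumption|exact Q2].
  apply Rmult_le_pos; apply Cmod_ge_0. }
assert (F3 : (Cmod (s ^ n) * Cmod (b n (x + y)%C - b n x - C_derive (b n) x * y)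
   <= T * (B / rho / rho * Cmod y ^ 2))%R).
{ apply Rmult_le_compat; try apply Cmod_ge_0; assumption. }
apply Rle_trans with ((T * B) * (/ r * Cmod u + / rho * Cmod y) ^ 2)%R.
- eapply Rle_trans; [apply Rplus_le_compat; [exact F1|apply Rplus_le_compat; [exact F2|exact F3]]|].
  assert (0 <= T * B)%R by (apply Rmult_le_pos; assumption).
  assert (0 <= (/ r * Cmod u) * (/ rho * Cmod y))%R
    by (repeat apply Rmult_le_pos; lra).
  unfold Rdiv.
  (* With [a = |u| / r] and [c = |y| / rho], the three bounds add up to [T B (a^2 + a c + c^2)]. *)
  replace (T * / r * / r * Cmod u ^ 2 * B + (T * / r * Cmod u * (B * / rho * Cmod y) +
     T * (B * / rho * / rho * Cmod y ^ 2)))%R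
    with (T * B * ((/ r * Cmod u + / rho * Cmod y) ^ 2 - (/ r * Cmod u) * (/ rho * Cmod y)))%R
    by ring.
  apply Rmult_le_compat_l; [assumption|lra].
- replace (M * (k * m) ^ 2 * (1 / 2) ^ n)%R with ((T * B) * (k * m) ^ 2)%R
    by (rewrite TB; ring).
  apply Rmult_le_compat_l; [apply Rmult_le_pos; assumption|].
  apply pow_incr; split.
  + apply Rplus_le_le_0_compat; apply Rmult_le_pos; lra.
  + unfold k, m; nra.
Qed.

Lemma geometric_coeffs_ext (x0 : C) (R0 M K : R) (a b : nat -> C -> C) :
  (forall n x, a n x = b n x) ->
  geometric_coeffs x0 R0 M K a -> geometric_coeffs x0 R0 M K b.
Proof.
intros E [H1 H2 H3 H4 H5]; split; [exact H1|exact H2|exact H3| |].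
- intros n v Hv; destruct (H4 n v Hv) as [l Hl]; exists l.
  revert Hl; apply is_derive_C_ext, E.
- intros n v Hv; rewrite <- E; apply H5, Hv.
Qed.

Lemma geometric_coeffs_shift (x0 : C) (R0 M K : R) (b : nat -> C -> C) :
  geometric_coeffs x0 R0 M K b -> geometric_coeffs x0 R0 (M * K) K (fun n => b (S n)).
Proof.
intros [H1 H2 H3 H4 H5]; split; [exact H1|nra|exact H3| |].
- intros n v; apply H4.
- intros n v Hv; replace (M * K * K ^ n)%R with (M * K ^ S n)%R by (simpl; ring).
  apply H5, Hv.
Qed.

Lemma power_sum_ext (a b : nat -> C -> C) (q : C * C) :
  (forall n x, a n x = b n x) -> power_sum a q = power_sum b q.
Proof.
intros E; unfold power_sum, Cseries.
f_equal; apply Series_ext; intros n; rewrite E; reflexivity.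
Qed.

Lemma power_sum_local (x0 : C) (R0 M K : R) (b : nat -> C -> C) :
  geometric_coeffs x0 R0 M K b ->
  exists d : R, (0 < d)%R /\ forall s x, (Cmod s < d)%R -> (Cmod (x - x0) < R0 / 2)%R ->
    frechet (power_sum b) (s, x)
      (power_sum (coeffs_ds b) (s, x)) (power_sum (coeffs_dx b) (s, x)) /\
    is_Cseries (fun n => b n x * s ^ n) (power_sum b (s, x)).
Proof.
intros H; assert (HK := gc_K _ _ _ _ _ H); assert (HR := gc_R _ _ _ _ _ H).
assert (P : (0 < / (4 * K))%R) by (apply Rinv_0_lt_compat; lra).
exists (/ (4 * K))%R; split; [exact P|].
intros s x Hs Hx; split.
- apply (frechet_power_sum x0 R0 M K); assumption.
- apply (power_sum_correct x0 R0 M K); [exact H| |lra].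
  replace (/ (2 * K))%R with (2 * / (4 * K))%R by (field; lra). lra.
Qed.

Lemma is_Cseries_at_0 (a : nat -> C) (s : C) :
  is_Cseries (fun n => a n * 0 ^ n) s -> s = a 0%nat.
Proof.
intros H.
rewrite <- (is_Cseries_unique _ _ H).
apply is_Cseries_unique.
(* The tail vanishes termwise; scaling the given series by 0 supplies its convergence. *)
assert (H0 : is_Cseries (fun n => a (S n) * 0 ^ S n) 0).
{ apply (is_Cseries_scal 0) in H; rewrite Cmult_0_l in H.
  revert H; apply is_Cseries_ext; intros n; simpl; ring. }
apply (is_Cseries_decr_1 (fun n => a n * 0 ^ n)) in H0.
replace (a 0%nat) with (a 0%nat * 0 ^ 0 + 0) by (simpl; ring); exact H0.
Qed.

(** * The formal solution and its convergence *)

Section HeatCoefficients.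

Variables k v : C -> C.

(* Substituting [sum_n d_n(x) s^n / n!] with [s = t - xi(x)] and [v = xi'] in
   [chi_x + k chi = chi_tt] gives the recursion; [d_0 = 0] and [d_1 = 1] make
   [chi] vanish to first order on the surface. *)
Fixpoint heat_coeff_pair (n : nat) : (C -> C) * (C -> C) :=
  match n with
  | O => (fun _ => RtoC 0, fun _ => RtoC 1)
  | S m => let '(a, b) := heat_coeff_pair m in
      (b, fun x => C_derive a x + k x * a x - v x * b x)
  end.

Definition heat_coeff (n : nat) : C -> C := fst (heat_coeff_pair n).

Lemma heat_coeff_SS (n : nat) (x : C) :
  heat_coeff (S (S n)) x =
  C_derive (heat_coeff n) x + k x * heat_coeff n x - v x * heat_coeff (S n) x.
Proof.
unfold heat_coeff; simpl; destruct (heat_coeff_pair n) as [a b]; reflexivity.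
Qed.

Variables (x0 : C) (R0 A : R).
Hypothesis HR : (0 < R0)%R.
Hypothesis Hk : forall x, (Cmod (x - x0) < R0)%R -> ex_derive k x /\ (Cmod (k x) <= A)%R.
Hypothesis Hv : forall x, (Cmod (x - x0) < R0)%R -> ex_derive v x /\ (Cmod (v x) <= A)%R.

(** Consecutive coefficients are carried together through the two-step recursion. Mere
    differentiability survives on the full disc; only bounds cost radius. *)
Lemma ex_derive_heat_coeff (n : nat) : forall x, (Cmod (x - x0) < R0)%R ->
  ex_derive (heat_coeff n) x.
Proof.
cut ((forall x, (Cmod (x - x0) < R0)%R -> ex_derive (heat_coeff n) x) /\
     (forall x, (Cmod (x - x0) < R0)%R -> ex_derive (heat_coeff (S n)) x)); [tauto|].
induction n as [|n [IH1 IH2]].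
- split; intros x _; exists (RtoC 0); [exact (is_derive_Cconst 0 x)|exact (is_derive_Cconst 1 x)].
- split; [exact IH2|]; intros x Hx.
  destruct (ex_derive_C_derive_disc _ x0 R0 IH1 x Hx) as [l1 H1].
  destruct (IH1 x Hx) as [l2 H2]; destruct (IH2 x Hx) as [l3 H3].
  destruct (Hk x Hx) as [[l4 H4] _]; destruct (Hv x Hx) as [[l5 H5] _].
  eexists; apply (is_derive_C_ext (fun w => C_derive (heat_coeff n) w
    + k w * heat_coeff n w - v w * heat_coeff (S n) w)).
  + intros w; symmetry; apply heat_coeff_SS.
  + apply is_derive_Cminus; [apply is_derive_Cplus; [exact H1|]|];
      apply is_derive_Cmult; eassumption.
Qed.

(** Cauchy's estimate turns the recursion into a factor [1/r + A + A q], and the condition on [q]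
    bounds it by [q^2]. The radius [r] stays free so that it can depend on the index finally
    reached. *)
Lemma Cmod_heat_coeff_le (r q : R) (n : nat) : (0 < r)%R -> (/ r + 2 * A + 1 <= q)%R ->
  forall x, (Cmod (x - x0) < R0 - INR n * r)%R -> (Cmod (heat_coeff n x) <= q ^ n)%R.
Proof.
intros Hr Hq.
assert (HA : (0 <= A)%R).
{ apply Rle_trans with (Cmod (k x0)); [apply Cmod_ge_0|apply Hk].
  replace (x0 - x0) with (RtoC 0) by ring; rewrite Cmod_0; exact HR. }
assert (Hr' : (0 < / r)%R) by (apply Rinv_0_lt_compat, Hr).
cut ((forall x, (Cmod (x - x0) < R0 - INR n * r)%R -> (Cmod (heat_coeff n x) <= q ^ n)%R) /\
  (forall x, (Cmod (x - x0) < R0 - INR (S n) * r)%R -> (Cmod (heat_coeff (S n) x) <= q ^ S n)%R));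
  [tauto|].
induction n as [|n [IH1 IH2]].
- split; intros x _; unfold heat_coeff; simpl.
  + rewrite Cmod_0; lra.
  + rewrite Cmod_1; lra.
- split; [exact IH2|]; intros x Hx; rewrite heat_coeff_SS.
  rewrite !S_INR in *.
  assert (Pn : (0 <= INR n * r)%R) by (apply Rmult_le_pos; [apply pos_INR|lra]).
  assert (Hx0 : (Cmod (x - x0) < R0)%R) by lra.
  assert (E1 : (Cmod (C_derive (heat_coeff n) x) <= q ^ n / r)%R).
  { apply (Cauchy_estimate_disc _ x0 x (R0 - INR n * r)); [exact Hr| |lra].
    intros w Hw; split; [apply ex_derive_heat_coeff; lra|apply IH1, Hw]. }
  assert (E2 := IH1 x ltac:(lra)); assert (E3 := IH2 x ltac:(lra)).
  destruct (Hk x Hx0) as [_ E4]; destruct (Hv x Hx0) as [_ E5].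
  assert (Hqn : (0 <= q ^ n)%R) by (apply pow_le; lra).
  unfold Cminus; eapply Rle_trans; [apply Cmod_triangle|]; rewrite Cmod_opp.
  eapply Rle_trans; [apply Rplus_le_compat_r, Cmod_triangle|].
  rewrite !Cmod_mult.
  assert (E6 : (Cmod (k x) * Cmod (heat_coeff n x) <= A * q ^ n)%R)
    by (apply Rmult_le_compat; try apply Cmod_ge_0; assumption).
  assert (E7 : (Cmod (v x) * Cmod (heat_coeff (S n) x) <= A * q ^ S n)%R)
    by (apply Rmult_le_compat; try apply Cmod_ge_0; assumption).
  unfold Rdiv in E1; simpl in E7 |- *.
  assert (q ^ n * / r + A * q ^ n + A * (q * q ^ n) <= q * (q * q ^ n))%R; [|lra].
  replace (q ^ n * / r + A * q ^ n + A * (q * q ^ n))%R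
    with ((/ r + A + A * q) * q ^ n)%R by ring.
  replace (q * (q * q ^ n))%R with (q * q * q ^ n)%R by ring.
  apply Rmult_le_compat_r; [exact Hqn|nra].
Qed.

End HeatCoefficients.

(** The induction step is [(1 + 1/N)^N <= e <= 3]. *)
Lemma pow_self_le_fact (n : nat) : (INR n ^ n <= 3 ^ n * INR (fact n))%R.
Proof.
induction n as [|n IH]; [simpl; lra|].
destruct n as [|m]; [simpl; lra|].
set (N := S m) in *.
assert (HN : (0 < INR N)%R) by (apply lt_0_INR; unfold N; lia).
assert (E : (INR (S N) ^ N <= 3 * INR N ^ N)%R).
{ rewrite S_INR.
  replace (INR N + 1)%R with (INR N * (1 + / INR N))%R by (field; lra).
  rewrite Rpow_mult_distr, Rmult_comm.
  apply Rmult_le_compat_r; [apply pow_le; lra|].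
  apply Rle_trans with (exp (/ INR N) ^ N)%R.
  - apply pow_incr; split; [|apply exp_ineq1_le].
    pose proof (Rinv_0_lt_compat _ HN); lra.
  - assert (Ep : forall n y, (exp y ^ n = exp (INR n * y))%R).
    { intros n y; induction n as [|n IHn].
      - simpl; rewrite Rmult_0_l, exp_0; reflexivity.
      - rewrite S_INR, Rmult_plus_distr_r, Rmult_1_l, exp_plus, <- IHn; simpl; ring. }
    rewrite Ep, Rinv_r by lra; apply exp_le_3. }
rewrite fact_simpl, mult_INR.
change (INR (S N) ^ S N)%R with (INR (S N) * INR (S N) ^ N)%R.
apply Rle_trans with (INR (S N) * (3 * (3 ^ N * INR (fact N))))%R.
- apply Rmult_le_compat_l; [apply pos_INR|].
  eapply Rle_trans; [exact E|apply Rmult_le_compat_l; [lra|exact IH]].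
- simpl pow; lra.
Qed.

(** The coefficient of [s^n] in the m-th s-derivative of [chi]. *)
Definition heat_series_coeff (k v : C -> C) (m n : nat) (x : C) : C :=
  / INR (fact n) * heat_coeff k v (n + m) x.

Lemma INR_fact_C_neq_0 (n : nat) : RtoC (INR (fact n)) <> 0.
Proof. intros E; apply (INR_fact_neq_0 n); exact (f_equal fst E). Qed.

Lemma coeffs_ds_heat (k v : C -> C) (m n : nat) (x : C) :
  coeffs_ds (heat_series_coeff k v m) n x = heat_series_coeff k v (S m) n x.
Proof.
unfold coeffs_ds, heat_series_coeff.
rewrite <- plus_n_Sm; simpl (S n + m)%nat.
rewrite fact_simpl, mult_INR, RtoC_mult.
field; split; [apply INR_fact_C_neq_0|].
intros E; apply (not_0_INR (S n)); [lia|exact (f_equal fst E)].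
Qed.

Lemma geometric_heat_coeffs_0 (k v : C -> C) (x0 : C) (R0 A : R) : (0 < R0)%R ->
  (forall x, (Cmod (x - x0) < R0)%R -> ex_derive k x /\ (Cmod (k x) <= A)%R) ->
  (forall x, (Cmod (x - x0) < R0)%R -> ex_derive v x /\ (Cmod (v x) <= A)%R) ->
  exists K, geometric_coeffs x0 (R0 / 2) 1 K (heat_series_coeff k v 0).
Proof.
intros HR Hk Hv.
assert (HA : (0 <= A)%R).
{ apply Rle_trans with (Cmod (k x0)); [apply Cmod_ge_0|apply Hk].
  replace (x0 - x0) with (RtoC 0) by ring; rewrite Cmod_0; exact HR. }
(* Chosen so that [n c] is an admissible [q] for [r = R0 / (2 n)] and every [n >= 1]; the 3 below
   comes from [pow_self_le_fact]. *)
set (c := (2 / R0 + 2 * A + 1)%R).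
assert (Hc : (0 < 2 / R0)%R) by (apply Rdiv_lt_0_compat; lra).
exists (3 * c)%R; split; [lra|lra|unfold c; lra| |].
- intros n x Hx.
  destruct (ex_derive_heat_coeff k v x0 R0 A Hk Hv (n + 0) x ltac:(lra)) as [l Hl].
  exists (/ INR (fact n) * l); apply is_derive_Cscal, Hl.
- intros n x Hx; rewrite Rmult_1_l; unfold heat_series_coeff; rewrite Nat.add_0_r.
  assert (Hfn := INR_fact_lt_0 n).
  rewrite Cmod_mult, Cmod_inv, Cmod_R, Rabs_pos_eq by (lra || apply INR_fact_C_neq_0).
  (* The index 0 is separate, as [r] divides by it; there the coefficient is zero. *)
  destruct n as [|m].
  { unfold heat_coeff; simpl; rewrite Cmod_0; lra. }
  set (N := S m) in *.
  assert (HN : (1 <= INR N)%R) by (unfold N; rewrite S_INR; pose proof (pos_INR m); lra).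
  set (r := (R0 / (2 * INR N))%R).
  assert (Hr : (0 < r)%R) by (apply Rdiv_lt_0_compat; lra).
  assert (Hq : (/ r + 2 * A + 1 <= INR N * c)%R).
  { replace (/ r)%R with (INR N * (2 / R0))%R by (unfold r; field; lra).
    unfold c; nra. }
  assert (B := Cmod_heat_coeff_le k v x0 R0 A HR Hk Hv r _ N Hr Hq x).
  replace (R0 - INR N * r)%R with (R0 / 2)%R in B by (unfold r; field; lra).
  specialize (B Hx).
  apply (Rmult_le_reg_l (INR (fact N))); [exact Hfn|].
  rewrite <- Rmult_assoc, Rinv_r, Rmult_1_l by lra.
  eapply Rle_trans; [exact B|].
  rewrite !Rpow_mult_distr, <- Rmult_assoc.
  apply Rmult_le_compat_r; [apply pow_le; unfold c; lra|].
  rewrite (Rmult_comm (INR (fact N))); apply pow_self_le_fact.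
Qed.

Lemma geometric_heat_coeffs (k v : C -> C) (x0 : C) (R0 A : R) (m : nat) : (0 < R0)%R ->
  (forall x, (Cmod (x - x0) < R0)%R -> ex_derive k x /\ (Cmod (k x) <= A)%R) ->
  (forall x, (Cmod (x - x0) < R0)%R -> ex_derive v x /\ (Cmod (v x) <= A)%R) ->
  exists M K, geometric_coeffs x0 (R0 / 2) M K (heat_series_coeff k v m).
Proof.
intros HR Hk Hv; induction m as [|m [M [K IH]]].
- destruct (geometric_heat_coeffs_0 k v x0 R0 A HR Hk Hv) as [K H]; exists 1%R, K; exact H.
- exists (M * K)%R, (2 * K)%R.
  apply (geometric_coeffs_ext _ _ _ _ (coeffs_ds (heat_series_coeff k v m))).
  + intros n x; apply coeffs_ds_heat.
  + apply geometric_coeffs_ds, IH.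
Qed.

Definition heat_sum (k v : C -> C) (m : nat) : C * C -> C :=
  power_sum (heat_series_coeff k v m).

(** The x-derivative is the recursion solved for [d_n'] and summed: the equation for [chi] in the
    variables [(s, x)], with the drift [v chi_s] still present. *)
Lemma frechet_heat_sum (k v : C -> C) (x0 : C) (R0 A : R) (m : nat) : (0 < R0)%R ->
  (forall x, (Cmod (x - x0) < R0)%R -> ex_derive k x /\ (Cmod (k x) <= A)%R) ->
  (forall x, (Cmod (x - x0) < R0)%R -> ex_derive v x /\ (Cmod (v x) <= A)%R) ->
  exists d : R, (0 < d)%R /\ forall s x, (Cmod s < d)%R -> (Cmod (x - x0) < R0 / 4)%R ->
    frechet (heat_sum k v m) (s, x) (heat_sum k v (S m) (s, x))
      (heat_sum k v (S (S m)) (s, x) - k x * heat_sum k v m (s, x)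
       + v x * heat_sum k v (S m) (s, x)).
Proof.
intros HR Hk Hv.
destruct (geometric_heat_coeffs k v x0 R0 A m HR Hk Hv) as [M0 [K0 G0]].
destruct (geometric_heat_coeffs k v x0 R0 A (S m) HR Hk Hv) as [M1 [K1 G1]].
destruct (geometric_heat_coeffs k v x0 R0 A (S (S m)) HR Hk Hv) as [M2 [K2 G2]].
apply power_sum_local in G0; destruct G0 as [d0 [Hd0 G0]].
apply power_sum_local in G1; destruct G1 as [d1 [Hd1 G1]].
apply power_sum_local in G2; destruct G2 as [d2 [Hd2 G2]].
exists (Rmin d0 (Rmin d1 d2)); split; [repeat apply Rmin_pos; assumption|].
intros s x Hs Hx.
pose proof (Rmin_l d0 (Rmin d1 d2)); pose proof (Rmin_r d0 (Rmin d1 d2)).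
pose proof (Rmin_l d1 d2); pose proof (Rmin_r d1 d2).
destruct (G0 s x ltac:(lra) ltac:(lra)) as [F0 S0].
destruct (G1 s x ltac:(lra) ltac:(lra)) as [_ S1].
destruct (G2 s x ltac:(lra) ltac:(lra)) as [_ S2].
clear G0 G1 G2.
rewrite (power_sum_ext _ _ (s, x) (coeffs_ds_heat k v m)) in F0.
replace (power_sum (coeffs_dx (heat_series_coeff k v m)) (s, x)) with
  (heat_sum k v (S (S m)) (s, x) - k x * heat_sum k v m (s, x)
    + v x * heat_sum k v (S m) (s, x)) in F0; [exact F0|].
symmetry; apply is_Cseries_unique.
assert (S3 := is_Cseries_plus _ _ _ _
  (is_Cseries_minus _ _ _ _ S2 (is_Cseries_scal (k x) _ _ S0)) (is_Cseries_scal (v x) _ _ S1)).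
revert S3; apply is_Cseries_ext; intros n; simpl fst; simpl snd.
assert (E : coeffs_dx (heat_series_coeff k v m) n x
  = / INR (fact n) * C_derive (heat_coeff k v (n + m)) x).
{ apply is_C_derive_unique, is_derive_Cscal, is_derive_C_derive.
  apply (ex_derive_heat_coeff k v x0 R0 A Hk Hv); lra. }
rewrite E; unfold heat_series_coeff.
rewrite <- !plus_n_Sm, heat_coeff_SS; ring.
Qed.

(* [psi = chi / s], holomorphic across the surface. *)
Definition heat_quotient_coeff (k v : C -> C) (n : nat) : C -> C :=
  heat_series_coeff k v 0 (S n).

(** The values at [s = 0] are [d_1], [d_2 / 2] and [d_3 / 3], where [d_2 = - v] and
    [d_3 = k + v^2]. *)
Lemma heat_quotient_local (k v : C -> C) (x0 : C) (R0 A : R) : (0 < R0)%R ->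
  (forall x, (Cmod (x - x0) < R0)%R -> ex_derive k x /\ (Cmod (k x) <= A)%R) ->
  (forall x, (Cmod (x - x0) < R0)%R -> ex_derive v x /\ (Cmod (v x) <= A)%R) ->
  exists (psi psi1 psi2 : C * C -> C) (d : R), (0 < d)%R /\
  forall s x, (Cmod s < d)%R -> (Cmod (x - x0) < R0 / 4)%R ->
    (exists B, frechet psi (s, x) (psi1 (s, x)) B) /\
    (exists B, frechet psi1 (s, x) (psi2 (s, x)) B) /\
    (exists A' B, frechet psi2 (s, x) A' B) /\
    heat_sum k v 0 (s, x) = s * psi (s, x) /\
    psi (RtoC 0, x) = 1 /\ psi1 (RtoC 0, x) = - (v x / 2) /\
    psi2 (RtoC 0, x) = (k x + v x * v x) / 3.
Proof.
intros HR Hk Hv.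
destruct (geometric_heat_coeffs_0 k v x0 R0 A HR Hk Hv) as [K G].
assert (G0 := geometric_coeffs_shift _ _ _ _ _ G).
assert (G1 := geometric_coeffs_ds _ _ _ _ _ G0).
assert (G2 := geometric_coeffs_ds _ _ _ _ _ G1).
apply power_sum_local in G; destruct G as [d [Hd G]].
apply power_sum_local in G0; destruct G0 as [d0 [Hd0 G0]].
apply power_sum_local in G1; destruct G1 as [d1 [Hd1 G1]].
apply power_sum_local in G2; destruct G2 as [d2 [Hd2 G2]].
set (b := heat_quotient_coeff k v).
exists (power_sum b), (power_sum (coeffs_ds b)), (power_sum (coeffs_ds (coeffs_ds b))).
exists (Rmin (Rmin d d0) (Rmin d1 d2)); split; [repeat apply Rmin_pos; assumption|].
intros s x Hs Hx.
pose proof (Rmin_l (Rmin d d0) (Rmin d1 d2)); pose proof (Rmin_r (Rmin d d0) (Rmin d1 d2)).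
pose proof (Rmin_l d d0); pose proof (Rmin_r d d0).
pose proof (Rmin_l d1 d2); pose proof (Rmin_r d1 d2).
assert (Z : Cmod 0 = 0%R) by apply Cmod_0.
destruct (G s x ltac:(lra) ltac:(lra)) as [_ S].
destruct (G0 s x ltac:(lra) ltac:(lra)) as [F0 S0].
destruct (G1 s x ltac:(lra) ltac:(lra)) as [F1 _].
destruct (G2 s x ltac:(lra) ltac:(lra)) as [F2 _].
destruct (G0 0 x ltac:(lra) ltac:(lra)) as [_ T0].
destruct (G1 0 x ltac:(lra) ltac:(lra)) as [_ T1].
destruct (G2 0 x ltac:(lra) ltac:(lra)) as [_ T2].
apply (is_Cseries_at_0 (fun n => heat_series_coeff k v 0 (Datatypes.S n) x)) in T0.
apply (is_Cseries_at_0 (fun n => coeffs_ds b n x)) in T1.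
apply (is_Cseries_at_0 (fun n => coeffs_ds (coeffs_ds b) n x)) in T2.
assert (D0 : forall y, C_derive (heat_coeff k v 0) y = 0)
  by (intros y; apply is_C_derive_unique; exact (is_derive_Cconst 0 y)).
assert (D1 : forall y, C_derive (heat_coeff k v 1) y = 0)
  by (intros y; apply is_C_derive_unique; exact (is_derive_Cconst 1 y)).
assert (V0 : forall y, heat_coeff k v 0 y = 0) by reflexivity.
assert (V1 : forall y, heat_coeff k v 1 y = 1) by reflexivity.
assert (V2 : forall y, heat_coeff k v 2 y = - v y).
{ intros y; rewrite heat_coeff_SS, D0, V0, V1; ring. }
assert (V3 : forall y, heat_coeff k v 3 y = k y + v y * v y).
{ intros y; rewrite heat_coeff_SS, D1, V1, V2; ring. }
refine (conj _ (conj _ (conj _ (conj _ (conj _ (conj _ _)))))).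
- eexists; exact F0.
- eexists; exact F1.
- do 2 eexists; exact F2.
- apply is_Cseries_unique; cbv beta.
  replace (s * power_sum b (s, x))
    with (heat_series_coeff k v 0 0 x * s ^ 0 + s * power_sum b (s, x)).
  2:{ unfold heat_series_coeff; rewrite V0; ring. }
  apply (is_Cseries_decr_1 (fun n => heat_series_coeff k v 0 n x * s ^ n)).
  apply (is_Cseries_scal s) in S0; revert S0; apply is_Cseries_ext; intros n; simpl; ring.
- eapply eq_trans; [exact T0|].
  unfold heat_series_coeff; simpl; rewrite V1; field.
- eapply eq_trans; [exact T1|].
  unfold coeffs_ds, b, heat_quotient_coeff, heat_series_coeff; simpl (_ + 0)%nat; rewrite V2.
  change (fact 2) with 2%nat; rewrite (INR_IZR_INZ 1), (INR_IZR_INZ 2); simpl; field.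
- eapply eq_trans; [exact T2|].
  unfold coeffs_ds, b, heat_quotient_coeff, heat_series_coeff; simpl (_ + 0)%nat; rewrite V3.
  change (fact 3) with 6%nat.
  rewrite (INR_IZR_INZ 1), (INR_IZR_INZ 2), (INR_IZR_INZ 6); simpl; field.
Qed.

Lemma Cminus_eq_0 (a b : C) : a - b = 0 -> a = b.
Proof. intros E; replace a with (a - b + b) by ring; rewrite E; ring. Qed.

Lemma locally_C2 (p : C * C) (P : C * C -> Prop) (d : R) : (0 < d)%R ->
  (forall t x : C, (Cmod (t - fst p) < d)%R -> (Cmod (x - snd p) < d)%R -> P (t, x)) ->
  locally (T := prod_UniformSpace C_UniformSpace C_UniformSpace) p P.
Proof.
intros Hd H.
assert (Hd2 : (0 < d / 2)%R) by lra.
(* A ball of the product structure on C bounds the modulus only up to [sqrt 2]. *)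
assert (S : (sqrt 2 * (d / 2) < d)%R).
{ assert (Q : (sqrt 2 < 2)%R).
  { rewrite <- (sqrt_square 2) at 2 by lra; apply sqrt_lt_1; lra. }
  pose proof (Rmult_lt_compat_r (d / 2) _ _ Hd2 Q); lra. }
exists (mkposreal (d / 2) Hd2); intros [t x] [B1 B2].
apply H.
- eapply Rlt_trans; [apply (C_NormedModule_mixin_compat2 _ _ _ B1)|exact S].
- eapply Rlt_trans; [apply (C_NormedModule_mixin_compat2 _ _ _ B2)|exact S].
Qed.

Lemma ex_derive_locally_bounded (g : C -> C) (x0 : C) : ex_derive g x0 ->
  exists d : R, (0 < d)%R /\
    forall x, (Cmod (x - x0) < d)%R -> (Cmod (g x) <= Cmod (g x0) + 1)%R.
Proof.
intros [l Hl].
destruct (proj1 (continuous_C_iff g x0) (is_derive_C_continuous g x0 l Hl) 1%R Rlt_0_1)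
  as [d [Hd H]].
exists d; split; [exact Hd|]; intros x Hx; specialize (H x Hx).
pose proof (Cmod_abs_sub (g x) (g x0)); lra.
Qed.

(** * Burgers' equation and the limit on the surface *)

(* The Cole-Hopf computation: [X0], ..., [X3] are the successive t-derivatives of
   [chi], and the x-derivatives of [X0], [X1] are [X2 - k X0], [X3 - k X1]. *)
Lemma Cole_Hopf_identity (X0 X1 X2 X3 k : C) : X0 <> 0 ->
  - (2) * (((X3 - k * X1) * X0 - X1 * (X2 - k * X0)) / (X0 * X0)) +
  - (2) * (X1 / X0) * (- (2) * ((X2 * X0 - X1 * X1) / (X0 * X0))) =
  - (2) * (((X3 * X0 + X2 * X1 - (X2 * X1 + X1 * X2)) * (X0 * X0)
     - (X2 * X0 - X1 * X1) * (X1 * X0 + X0 * X1)) / ((X0 * X0) * (X0 * X0))).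
Proof. intros H; field; exact H. Qed.

(** With [s = t - z] the double poles cancel and [H + 2 (h - v) / s - (h - v)^2 / 2] remains; as
    [h(z) = v], it tends to [h1 + 2 h1 + 0]. *)
Lemma singular_part_limit (z v h1 : C) (h H : C -> C) (d : R) : (0 < d)%R ->
  h z = v -> H z = h1 -> is_derive h z h1 -> ex_derive H z ->
  forall (ut u : C -> C),
  (forall t, t <> z -> (Cmod (t - z) < d)%R ->
     u t = - (2 / (t - z)) + h t /\ ut t = 2 / ((t - z) * (t - z)) + H t) ->
  filterlim (fun t => ut t - 1 / 2 * (u t - v) ^ 2)
    (locally' (T := C_UniformSpace) z) (locally (T := C_UniformSpace) (3 * h1)).
Proof.
intros Hd Hz HHz Dh [l DH] ut u E P HP.
apply locally_C_iff in HP; destruct HP as [eps [Heps HP]].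
(* The three terms contribute at most [e], [2 e] and [e / 2]; the bound 1 turns the square into a
   multiple of [e]. *)
set (e := Rmin 1 (eps / 4)).
assert (He : (0 < e)%R) by (apply Rmin_pos; lra).
assert (He1 : (e <= 1)%R) by apply Rmin_l.
assert (He2 : (e <= eps / 4)%R) by apply Rmin_r.
destruct (proj1 (is_derive_C_iff h z h1) Dh e He) as [d1 [Hd1 H1]].
destruct (proj1 (continuous_C_iff H z) (is_derive_C_continuous _ _ _ DH) e He) as [d2 [Hd2 H2]].
destruct (proj1 (continuous_C_iff h z) (is_derive_C_continuous _ _ _ Dh) e He) as [d3 [Hd3 H3]].
apply (proj2 (locally_C_iff z _)).
exists (Rmin (Rmin d d1) (Rmin d2 d3)); split; [repeat apply Rmin_pos; assumption|].
intros t Ht Hne; apply HP.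
pose proof (Rmin_l (Rmin d d1) (Rmin d2 d3)); pose proof (Rmin_r (Rmin d d1) (Rmin d2 d3)).
pose proof (Rmin_l d d1); pose proof (Rmin_r d d1).
pose proof (Rmin_l d2 d3); pose proof (Rmin_r d2 d3).
specialize (H1 t ltac:(lra)); specialize (H2 t ltac:(lra)); specialize (H3 t ltac:(lra)).
destruct (E t Hne ltac:(lra)) as [Eu Eut]; rewrite Eu, Eut; clear E Eu Eut.
assert (Ns : t - z <> 0).
{ intros Q; apply Hne, Cminus_eq_0, Q. }
rewrite Hz in H1, H3; rewrite HHz in H2.
replace (2 / ((t - z) * (t - z)) + H t - 1 / 2 * (- (2 / (t - z)) + h t - v) ^ 2 - 3 * h1)
  with ((H t - h1) + (2 * ((h t - v - h1 * (t - z)) / (t - z))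
     + - (1 / 2 * ((h t - v) * (h t - v))))) by (field; exact Ns).
eapply Rle_lt_trans; [apply Cmod_triangle|].
eapply Rle_lt_trans; [apply Rplus_le_compat_l, Cmod_triangle|].
rewrite Cmod_opp, !Cmod_mult, Cmod_div by exact Ns.
assert (Ps : (0 < Cmod (t - z))%R) by (apply Cmod_gt_0, Ns).
assert (Q1 : (Cmod (h t - v - h1 * (t - z)) / Cmod (t - z) <= e)%R).
{ apply (Rmult_le_reg_r (Cmod (t - z))); [exact Ps|].
  unfold Rdiv; rewrite Rmult_assoc, Rinv_l, Rmult_1_r by lra; exact H1. }
assert (C2 : Cmod 2 = 2%R) by (rewrite Cmod_R; apply Rabs_pos_eq; lra).
assert (C12 : Cmod (1 / 2) = (1 / 2)%R).
{ rewrite Cmod_div, C2, Cmod_1; [reflexivity|].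
  apply Cmod_gt_0; rewrite C2; lra. }
rewrite C2, C12.
assert (Q2 : (Cmod (h t - v) * Cmod (h t - v) <= e * 1)%R).
{ apply Rmult_le_compat; try apply Cmod_ge_0; lra. }
lra.
Qed.

Theorem theorem1 :
  forall (x0 : C) (Dxi Df : C -> Prop) (xi f : C -> C),
    open Dxi -> Dxi x0 -> holomorphic_on Dxi xi ->
    open Df -> Df x0 -> holomorphic_on Df f ->
    exists (W : C * C -> Prop) (h : C * C -> C),
      open W /\ W (xi x0, x0) /\
      (forall t x : C, W (t, x) -> Dxi x /\ Df x) /\
      holomorphic2_on W h /\
      let u := fun p : C * C => (- (2 / (fst p - xi (snd p))) + h p)%C in
      Burgers_on (fun p => W p /\ ~ surface xi p) u /\
      (forall x : C, W (xi x, x) ->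
        filterlim
          (fun t : C =>
             (dt u (t, x) - 1 / 2 * (u (t, x) - C_derive xi x) ^ 2)%C)
          (locally' (xi x)) (locally (f x))).
Proof.
intros x0 Dxi Df xi f Oxi Hxi0 Hxi Of Hf0 Hf.
destruct (proj1 (locally_C_iff x0 Dxi) (Oxi x0 Hxi0)) as [r1 [Hr1 B1]].
destruct (proj1 (locally_C_iff x0 Df) (Of x0 Hf0)) as [r2 [Hr2 B2]].
set (v := C_derive xi).
set (k := fun x => - (1 / 2) * (f x + 1 / 2 * (v x * v x))).
assert (Dv : forall x, (Cmod (x - x0) < r1)%R -> ex_derive v x).
{ apply ex_derive_C_derive_disc; intros x Hx; apply Hxi, B1, Hx. }
assert (Dk : forall x, (Cmod (x - x0) < Rmin r1 r2)%R -> ex_derive k x).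
{ intros x Hx; pose proof (Rmin_l r1 r2); pose proof (Rmin_r r1 r2).
  destruct (Dv x ltac:(lra)) as [l Hl]; destruct (Hf x) as [l' Hl']; [apply B2; lra|].
  eexists; apply is_derive_Cscal, is_derive_Cplus; [exact Hl'|].
  apply is_derive_Cscal, is_derive_Cmult; exact Hl. }
assert (Z0 : Cmod (x0 - x0) = 0%R) by (replace (x0 - x0) with (RtoC 0) by ring; apply Cmod_0).
assert (Hr12 : (0 < Rmin r1 r2)%R) by (apply Rmin_pos; assumption).
destruct (ex_derive_locally_bounded v x0) as [r3 [Hr3 B3]]; [apply Dv; lra|].
destruct (ex_derive_locally_bounded k x0) as [r4 [Hr4 B4]]; [apply Dk; lra|].
set (R0 := Rmin (Rmin r1 r2) (Rmin r3 r4)).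
assert (HR0 : (0 < R0)%R) by (repeat apply Rmin_pos; assumption).
assert (LR : (R0 <= r1 /\ R0 <= r2 /\ R0 <= Rmin r1 r2 /\ R0 <= r3 /\ R0 <= r4)%R).
{ unfold R0; pose proof (Rmin_l (Rmin r1 r2) (Rmin r3 r4));
  pose proof (Rmin_r (Rmin r1 r2) (Rmin r3 r4)).
  pose proof (Rmin_l r1 r2); pose proof (Rmin_r r1 r2).
  pose proof (Rmin_l r3 r4); pose proof (Rmin_r r3 r4); lra. }
set (A := (Cmod (v x0) + Cmod (k x0) + 1)%R).
assert (Hk : forall x, (Cmod (x - x0) < R0)%R -> ex_derive k x /\ (Cmod (k x) <= A)%R).
{ intros x Hx; split; [apply Dk; lra|].
  specialize (B4 x ltac:(lra)); pose proof (Cmod_ge_0 (v x0)); unfold A; lra. }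
assert (Hv : forall x, (Cmod (x - x0) < R0)%R -> ex_derive v x /\ (Cmod (v x) <= A)%R).
{ intros x Hx; split; [apply Dv; lra|].
  specialize (B3 x ltac:(lra)); pose proof (Cmod_ge_0 (k x0)); unfold A; lra. }
destruct (frechet_heat_sum k v x0 R0 A 0 HR0 Hk Hv) as [e0 [He0 F0]].
destruct (frechet_heat_sum k v x0 R0 A 1 HR0 Hk Hv) as [e1 [He1 F1]].
destruct (frechet_heat_sum k v x0 R0 A 2 HR0 Hk Hv) as [e2 [He2 F2]].
destruct (heat_quotient_local k v x0 R0 A HR0 Hk Hv) as [psi [psi1 [psi2 [e3 [He3 Q]]]]].
destruct (Q 0 x0) as [[Bp Fp] [_ [_ [_ [P0 _]]]]]; [rewrite Cmod_0; exact He3|lra|].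
destruct (frechet_Lipschitz _ _ _ _ Fp) as [K [e4 [HK [He4 L4]]]].
simpl in L4; rewrite P0 in L4.
(* Within this distance in both variables, [psi] differs from [psi(0, x0) = 1] by at most 1/2 and
   cannot vanish. *)
assert (He5 : (0 < / (4 * K))%R) by (apply Rinv_0_lt_compat; lra).
set (rho := Rmin (Rmin (Rmin e0 e1) (Rmin e2 e3)) (Rmin (Rmin e4 (/ (4 * K))) (R0 / 4))).
assert (Hrho : (0 < rho)%R) by (repeat apply Rmin_pos; lra).
assert (Lrho : (rho <= e0 /\ rho <= e1 /\ rho <= e2 /\ rho <= e3 /\ rho <= e4 /\
  rho <= / (4 * K) /\ rho <= R0 / 4)%R).
{ assert (T : forall a b c : R, (a <= Rmin b c -> a <= b /\ a <= c)%R)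
    by (intros a b c Ha; pose proof (Rmin_l b c); pose proof (Rmin_r b c); lra).
  destruct (T rho _ _ (Rle_refl _)) as [T1 T2].
  apply T in T1; apply T in T2; destruct T1 as [T1 T3], T2 as [T2 T4].
  apply T in T1; apply T in T2; apply T in T3; lra. }
(* A tube around the surface: its straightened form is a product of discs, the domain of the
   estimates in [(s, x)]. *)
set (W := fun p : C * C =>
  (Cmod (fst p - xi (snd p)) < rho)%R /\ (Cmod (snd p - x0) < rho)%R).
assert (Psi0 : forall s x, (Cmod s < rho)%R -> (Cmod (x - x0) < rho)%R -> psi (s, x) <> 0).
{ intros s x Hs Hx E.
  assert (Es : Cmod (s - 0) = Cmod s) by (f_equal; ring).
  specialize (L4 s x ltac:(lra) ltac:(lra)).
  rewrite E, Es in L4.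
  replace (0 - 1) with (- (1)) in L4 by ring; rewrite Cmod_opp, Cmod_1 in L4.
  assert (K * (Cmod s + Cmod (x - x0)) <= K * (2 * / (4 * K)))%R
    by (apply Rmult_le_compat_l; lra).
  replace (K * (2 * / (4 * K)))%R with (1 / 2)%R in H by (field; lra). lra. }
assert (Dxi1 : forall x, (Cmod (x - x0) < rho)%R -> is_derive xi x (v x)).
{ intros x Hx; apply is_derive_C_derive, Hxi, B1; lra. }
assert (OW : forall p, W p -> exists d : R, (0 < d)%R /\ forall t x : C,
  (Cmod (t - fst p) < d)%R -> (Cmod (x - snd p) < d)%R -> W (t, x)).
{ intros [t0 y0] [W1 W2]; simpl in W1, W2 |- *.
  set (d := Rmin ((rho - Cmod (t0 - xi y0)) / 2) (rho - Cmod (y0 - x0))).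
  assert (Hd : (0 < d)%R) by (apply Rmin_pos; lra).
  pose proof (Rmin_l ((rho - Cmod (t0 - xi y0)) / 2) (rho - Cmod (y0 - x0))) as D1.
  pose proof (Rmin_r ((rho - Cmod (t0 - xi y0)) / 2) (rho - Cmod (y0 - x0))) as D2.
  fold d in D1, D2.
  destruct (proj1 (continuous_C_iff xi y0)
    (is_derive_C_continuous _ _ _ (Dxi1 y0 W2)) d Hd) as [d' [Hd' C']].
  exists (Rmin d d'); split; [apply Rmin_pos; assumption|].
  intros t x Ht Hx; pose proof (Rmin_l d d'); pose proof (Rmin_r d d').
  specialize (C' x ltac:(lra)).
  split; simpl.
  - replace (t - xi x) with ((t - t0) + ((t0 - xi y0) + - (xi x - xi y0))) by ring.
    pose proof (Cmod_triangle (t - t0) ((t0 - xi y0) + - (xi x - xi y0))) as T1.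
    pose proof (Cmod_triangle (t0 - xi y0) (- (xi x - xi y0))) as T2.
    rewrite Cmod_opp in T2; lra.
  - pose proof (Cmod_sub_triangle x y0 x0); lra. }
set (sh := fun (G : C * C -> C) (p : C * C) => G (fst p - xi (snd p), snd p)).
set (h := fun p => - (2) * (sh psi1 p / sh psi p)).
(* [X m] is the m-th t-derivative of [chi] in the original variables. *)
set (X := fun m => sh (heat_sum k v m)).
(* The shift removes the drift and leaves [chi_x = chi_tt - k chi] for [chi] and its t-derivatives.
   Going up to [m = 2] provides the third t-derivative occurring in [u_tt]. *)
assert (FX : forall m, (m <= 2)%nat -> forall t x, W (t, x) ->
  frechet (X m) (t, x) (X (S m) (t, x)) (X (S (S m)) (t, x) - k x * X m (t, x))).
{ intros m Hm t x [W1 W2]; simpl in W1, W2.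
  assert (F : frechet (heat_sum k v m) (t - xi x, x) (heat_sum k v (S m) (t - xi x, x))
    (heat_sum k v (S (S m)) (t - xi x, x) - k x * heat_sum k v m (t - xi x, x)
     + v x * heat_sum k v (S m) (t - xi x, x))).
  { destruct m as [|[|[|m]]]; [apply F0|apply F1|apply F2|lia]; lra. }
  apply (frechet_shift _ xi _ _ _ _ (v x)) in F; [|apply Dxi1, W2].
  match type of F with frechet _ _ _ ?b =>
    replace b with (X (S (S m)) (t, x) - k x * X m (t, x)) in F end; [exact F|].
  unfold X, sh; simpl fst; simpl snd; ring. }
assert (FP : forall t x, W (t, x) ->
  (exists B, frechet (sh psi) (t, x) (sh psi1 (t, x)) B) /\
  (exists B, frechet (sh psi1) (t, x) (sh psi2 (t, x)) B) /\
  (exists A' B, frechet (sh psi2) (t, x) A' B) /\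
  X 0%nat (t, x) = (t - xi x) * sh psi (t, x) /\ sh psi (t, x) <> 0).
{ intros t x [W1 W2]; simpl in W1, W2.
  destruct (Q (t - xi x) x ltac:(lra) ltac:(lra))
    as [[Ba Fa] [[Bb Fb] [[Ac [Bc Fc]] [E0 _]]]].
  assert (D := Dxi1 x W2).
  refine (conj _ (conj _ (conj _ (conj E0 _)))).
  - eexists; apply (frechet_shift _ _ _ _ _ _ _ Fa D).
  - eexists; apply (frechet_shift _ _ _ _ _ _ _ Fb D).
  - do 2 eexists; apply (frechet_shift _ _ _ _ _ _ _ Fc D).
  - apply Psi0; assumption. }
assert (TW : forall t x, W (t, x) -> exists d : R, (0 < d)%R /\
  forall s, (Cmod (s - t) < d)%R -> W (s, x)).
{ intros t x Wp; destruct (OW _ Wp) as [d [Hd H]]; exists d; split; [exact Hd|].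
  intros s Hs; apply H; simpl; [exact Hs|].
  replace (x - x) with (RtoC 0) by ring; rewrite Cmod_0; exact Hd. }
(* Both sides are the t-derivative of [chi = s psi]. *)
assert (X1 : forall t x, W (t, x) ->
  X 1%nat (t, x) = sh psi (t, x) + (t - xi x) * sh psi1 (t, x)).
{ intros t x Wp; destruct (TW t x Wp) as [d [Hd H]].
  destruct (FP t x Wp) as [[Ba Fa] _].
  apply (is_derive_C_uniq (fun s => X 0%nat (s, x)) t).
  - apply (frechet_dt _ _ _ _ _ (FX 0%nat ltac:(lia) t x Wp)).
  - apply (is_derive_C_ext_loc (fun s => (s - xi x) * sh psi (s, x)) _ t _ d Hd).
    + intros s Hs; symmetry; apply FP, H, Hs.
    + replace (sh psi (t, x) + (t - xi x) * sh psi1 (t, x))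
        with ((1 - 0) * sh psi (t, x) + (t - xi x) * sh psi1 (t, x)) by ring.
      apply (is_derive_Cmult (fun s => s - xi x) (fun s => sh psi (s, x))).
      * apply is_derive_Cminus; [apply is_derive_Cid|apply is_derive_Cconst].
      * apply (frechet_dt _ _ _ _ _ Fa). }
set (u := fun p : C * C => (- (2 / (fst p - xi (snd p))) + h p)%C).
assert (Sne : forall t x, t <> xi x -> t - xi x <> 0).
{ intros t x N E; apply N, Cminus_eq_0, E. }
assert (X0ne : forall t x, W (t, x) -> t <> xi x -> X 0%nat (t, x) <> 0).
{ intros t x Wp N; destruct (FP t x Wp) as [_ [_ [_ [E Np]]]]; rewrite E.
  apply Cmult_neq_0; [apply Sne, N|exact Np]. }
assert (Hu : forall t x, W (t, x) -> t <> xi x ->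
  u (t, x) = - (2) * (X 1%nat (t, x) / X 0%nat (t, x))).
{ intros t x Wp N; destruct (FP t x Wp) as [_ [_ [_ [E Np]]]].
  rewrite E, (X1 t x Wp); unfold u, h; simpl fst; simpl snd.
  field; split; [exact Np|apply Sne, N]. }
(* The quotient rule for [u_t]. Naming it allows [dt u] to be replaced by [V] on a neighbourhood
   before differentiating again. *)
set (V := fun p : C * C => - (2) * ((X 2%nat p * X 0%nat p - X 1%nat p * X 1%nat p) /
   (X 0%nat p * X 0%nat p))).
assert (TWS : forall t x, W (t, x) -> t <> xi x -> exists d : R, (0 < d)%R /\
  forall s, (Cmod (s - t) < d)%R -> W (s, x) /\ s <> xi x).
{ intros t x Wp N; destruct (TW t x Wp) as [d [Hd H]].
  assert (P : (0 < Cmod (t - xi x))%R) by (apply Cmod_gt_0, Sne, N).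
  exists (Rmin d (Cmod (t - xi x))); split; [apply Rmin_pos; assumption|].
  intros s Hs; pose proof (Rmin_l d (Cmod (t - xi x))); pose proof (Rmin_r d (Cmod (t - xi x))).
  split; [apply H; lra|intros E; rewrite E, Cmod_sub_sym in Hs; lra]. }
assert (Dut : forall t x, W (t, x) -> t <> xi x ->
  is_derive (fun s => u (s, x)) t (V (t, x))).
{ intros t x Wp N; destruct (TWS t x Wp N) as [d [Hd H]].
  apply (is_derive_C_ext_loc (fun s => - (2) * (X 1%nat (s, x) / X 0%nat (s, x))) _ t _ d Hd).
  - intros s Hs; destruct (H s Hs); symmetry; apply Hu; assumption.
  - apply is_derive_Cscal.
    apply (is_derive_Cdiv (fun s => X 1%nat (s, x)) (fun s => X 0%nat (s, x)));
      [apply X0ne; assumption| |].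
    + apply (frechet_dt _ _ _ _ _ (FX 1%nat ltac:(lia) t x Wp)).
    + apply (frechet_dt _ _ _ _ _ (FX 0%nat ltac:(lia) t x Wp)). }
exists W, h; refine (conj _ (conj _ (conj _ (conj _ _)))); [| | | |cbv zeta; split].
- intros p Wp; destruct (OW p Wp) as [d [Hd H]]; apply (locally_C2 p W d Hd H).
- split; simpl; [|lra].
  replace (xi x0 - xi x0) with (RtoC 0) by ring; rewrite Cmod_0; exact Hrho.
- intros t x [_ W2]; simpl in W2; split; [apply B1|apply B2]; lra.
- intros [t x] Wp; destruct (FP t x Wp) as [[Ba Fa] [[Bb Fb] [_ [_ Np]]]].
  destruct (frechet_div _ _ _ _ _ _ _ Np Fb Fa) as [A' [B' Fd]].
  apply (frechet_ex_filterdiff h (t, x) (- (2) * A' + 0 * A') (- (2) * B' + 0 * B')).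
  (* A linear combination with second coefficient 0 serves as scalar multiplication. *)
  apply (frechet_lin (- (2)) 0 _ _ _ _ _ _ _ Fd) in Fd.
  revert Fd; apply frechet_ext; intros q; unfold h; ring.
- intros [t x] [Wp NS].
  assert (N : t <> xi x) by exact NS.
  assert (Vdt : forall s, W (s, x) -> s <> xi x -> dt u (s, x) = V (s, x)).
  { intros s Ws Ns; apply is_C_derive_unique, Dut; assumption. }
  assert (Fx0 := FX 0%nat ltac:(lia) t x Wp); assert (Fx1 := FX 1%nat ltac:(lia) t x Wp).
  assert (Fx2 := FX 2%nat ltac:(lia) t x Wp).
  assert (N0 := X0ne t x Wp N).
  assert (Dux : is_derive (fun y => u (t, y)) x
    (- (2) * (((X 3%nat (t, x) - k x * X 1%nat (t, x)) * X 0%nat (t, x) -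
       X 1%nat (t, x) * (X 2%nat (t, x) - k x * X 0%nat (t, x))) /
       (X 0%nat (t, x) * X 0%nat (t, x))))).
  { destruct (OW _ Wp) as [d [Hd H]]; simpl in H.
    (* Moving x also moves the surface; continuity of [xi] keeps [t] off it, so the quotient formula
       for u holds nearby. *)
    destruct (proj1 (continuous_C_iff xi x) (is_derive_C_continuous _ _ _ (Dxi1 x (proj2 Wp)))
      (Cmod (t - xi x))) as [d' [Hd' H']]; [apply Cmod_gt_0, Sne, N|].
    apply (is_derive_C_ext_loc (fun y => - (2) * (X 1%nat (t, y) / X 0%nat (t, y)))
      _ x _ (Rmin d d')); [apply Rmin_pos; assumption| |].
    - intros y Hy; pose proof (Rmin_l d d'); pose proof (Rmin_r d d').
      symmetry; apply Hu.
      + apply H; [|lra].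
        replace (t - t) with (RtoC 0) by ring; rewrite Cmod_0; exact Hd.
      + intros E; specialize (H' y ltac:(lra)); rewrite <- E in H'; lra.
    - apply is_derive_Cscal.
      apply (is_derive_Cdiv (fun y => X 1%nat (t, y)) (fun y => X 0%nat (t, y)) x);
        [exact N0| |].
      + apply (frechet_dx _ _ _ _ _ Fx1).
      + apply (frechet_dx _ _ _ _ _ Fx0). }
  assert (Dutt := frechet_dt _ _ _ _ _ Fx2).
  assert (Dut1 := frechet_dt _ _ _ _ _ Fx1).
  assert (Dut0 := frechet_dt _ _ _ _ _ Fx0).
  assert (DV : is_derive (fun s => dt u (s, x)) t
    (- (2) * (((X 3%nat (t, x) * X 0%nat (t, x) + X 2%nat (t, x) * X 1%nat (t, x)
      - (X 2%nat (t, x) * X 1%nat (t, x) + X 1%nat (t, x) * X 2%nat (t, x))) *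
        (X 0%nat (t, x) * X 0%nat (t, x))
     - (X 2%nat (t, x) * X 0%nat (t, x) - X 1%nat (t, x) * X 1%nat (t, x)) *
        (X 1%nat (t, x) * X 0%nat (t, x) + X 0%nat (t, x) * X 1%nat (t, x))) /
     ((X 0%nat (t, x) * X 0%nat (t, x)) * (X 0%nat (t, x) * X 0%nat (t, x)))))).
  { destruct (TWS t x Wp N) as [d [Hd H]].
    apply (is_derive_C_ext_loc (fun s => V (s, x)) _ t _ d Hd).
    - intros s Hs; destruct (H s Hs); symmetry; apply Vdt; assumption.
    - unfold V; apply is_derive_Cscal.
      apply (is_derive_Cdiv
        (fun s => X 2%nat (s, x) * X 0%nat (s, x) - X 1%nat (s, x) * X 1%nat (s, x))
        (fun s => X 0%nat (s, x) * X 0%nat (s, x)) t);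
        [apply Cmult_neq_0; exact N0| |].
      + apply is_derive_Cminus.
        * exact (is_derive_Cmult _ _ _ _ _ Dutt Dut0).
        * exact (is_derive_Cmult _ _ _ _ _ Dut1 Dut1).
      + exact (is_derive_Cmult _ _ _ _ _ Dut0 Dut0). }
  refine (conj _ (conj _ (conj _ _))).
  + eexists; apply Dut; assumption.
  + eexists; exact Dux.
  + eexists; exact DV.
  + refine (eq_trans (f_equal2 Cplus (is_C_derive_unique _ _ _ Dux)
      (f_equal2 Cmult (Hu t x Wp N) (Vdt t Wp N)))
      (eq_trans _ (eq_sym (is_C_derive_unique _ _ _ DV)))).
    apply Cole_Hopf_identity, N0.
- intros x Wp.
  destruct (TW _ _ Wp) as [d [Hd HW]].
  destruct (FP _ _ Wp) as [[Ba Fa] [[Bb Fb] [[Ac [Bc Fc]] [_ Np]]]].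
  destruct Wp as [_ W2]; simpl in W2.
  assert (Ez : xi x - xi x = 0) by ring.
  destruct (Q 0 x) as [_ [_ [_ [_ [P0' [P1' P2']]]]]]; [rewrite Cmod_0; lra|lra|].
  assert (Q0 : sh psi (xi x, x) = 1) by (unfold sh; simpl fst; simpl snd; rewrite Ez; exact P0').
  assert (Q1 : sh psi1 (xi x, x) = - (v x / 2))
    by (unfold sh; simpl fst; simpl snd; rewrite Ez; exact P1').
  assert (Q2 : sh psi2 (xi x, x) = (k x + v x * v x) / 3)
    by (unfold sh; simpl fst; simpl snd; rewrite Ez; exact P2').
  set (H := fun t => - (2) * ((sh psi2 (t, x) * sh psi (t, x) - sh psi1 (t, x) * sh psi1 (t, x)) /
     (sh psi (t, x) * sh psi (t, x)))).
  assert (Dh : forall t, W (t, x) -> is_derive (fun s => h (s, x)) t (H t)).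
  { intros t Wt; destruct (FP t x Wt) as [[Ba' Fa'] [[Bb' Fb'] [_ [_ Np']]]].
    apply is_derive_Cscal.
    apply (is_derive_Cdiv (fun s => sh psi1 (s, x)) (fun s => sh psi (s, x)));
      [exact Np'|apply (frechet_dt _ _ _ _ _ Fb')|apply (frechet_dt _ _ _ _ _ Fa')]. }
  assert (Wx : W (xi x, x)).
  { apply HW; replace (xi x - xi x) with (RtoC 0) by ring; rewrite Cmod_0; exact Hd. }
  (* Here [H (xi x) = -2 ((k + v^2) / 3 - v^2 / 4)], three times which is [-2 k - v^2 / 2 = f]. *)
  replace (f x) with (3 * H (xi x)).
  2:{ unfold H; rewrite Q0, Q1, Q2; unfold k; field. }
  apply (singular_part_limit (xi x) (C_derive xi x) (H (xi x)) (fun t => h (t, x)) H d Hd).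
  (* The regular part equals [xi'] on the surface because [psi_s = - xi' / 2] there; this removes
     the simple pole in the limit. *)
  + unfold h; rewrite Q0, Q1; fold v; field.
  + reflexivity.
  + apply Dh, Wx.
  + eexists; apply is_derive_Cscal.
    apply (is_derive_Cdiv
      (fun s => sh psi2 (s, x) * sh psi (s, x) - sh psi1 (s, x) * sh psi1 (s, x))
      (fun s => sh psi (s, x) * sh psi (s, x))); [apply Cmult_neq_0; exact Np| |].
    * apply is_derive_Cminus.
      -- exact (is_derive_Cmult _ _ _ _ _ (frechet_dt _ _ _ _ _ Fc) (frechet_dt _ _ _ _ _ Fa)).
      -- exact (is_derive_Cmult _ _ _ _ _ (frechet_dt _ _ _ _ _ Fb) (frechet_dt _ _ _ _ _ Fb)).
    * exact (is_derive_Cmult _ _ _ _ _ (frechet_dt _ _ _ _ _ Fa) (frechet_dt _ _ _ _ _ Fa)).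
  + intros t N Ht; split; [reflexivity|].
    apply is_C_derive_unique.
    assert (Ns := Sne t x N).
    apply is_derive_Cplus; [|apply Dh, HW, Ht].
    replace (2 / ((t - xi x) * (t - xi x))) with
      (- (2) * ((1 - 0) * (- / ((t - xi x) * (t - xi x))))) by (field; exact Ns).
    apply (is_derive_C_ext (fun s => - (2) * / (s - xi x)));
      [intros s; simpl fst; simpl snd; unfold Cdiv; ring|].
    apply is_derive_Cscal.
    apply (is_derive_Ccomp Cinv (fun s => s - xi x)); [apply is_derive_Cinv, Ns|].
    apply is_derive_Cminus; [apply is_derive_Cid|apply is_derive_Cconst].
Qed.
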